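(* Suppose $E$ is an admissible boundary point of the essential spectrum of $\tau_0$, with $u_0,v_0$ and $\alpha,\beta$ as in the definition of admissibility. Furthermore, suppose that, as $x\to\infty$, $$\Delta q,\ \Delta p=O\Big(\frac{\beta'}{\alpha^2\beta^2}\Big).$$ Then $\tau_1-E$ is relatively oscillatory with respect to $\tau_0-E$ if $$\inf_{\ell>0}\limsup_{x\to\infty}\frac1\ell\int_x^{x+\ell}\frac{\beta(t)^2}{\beta'(t)}\left(u_0(t)^2\,\Delta q(t)+(p_0(t)u_0'(t))^2\,\Delta p(t)\right)dt<-\frac14$$ and relatively nonoscillatory with respect to $\tau_0-E$ if $$\sup_{\ell>0}\liminf_{x\to\infty}\frac1\ell\int_x^{x+\ell}\frac{\beta(t)^2}{\beta'(t)}\left(u_0(t)^2\,\Delta q(t)+(p_0(t)u_0'(t))^2\,\Delta p(t)\right)dt>-\frac14 .$$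
   Context: Setting: $\tau_j=\frac1r\left(-\frac{d}{dx}p_j\frac{d}{dx}+q_j\right)$, $j=0,1$, on $(a,b)$ with $a\in\mathbb R$, $b=\infty$; the coefficients are real-valued with $p_j^{-1},q_j,r\in L^1_{loc}(a,b)$ and $p_j,r>0$. Standing assumptions: for both $\tau_j$ the endpoint $a$ is regular (i.e. $q_j,p_j^{-1},r$ are integrable near $a$) and $b$ is limit point (i.e. $(\tau_j-z)u=0$ has, up to multiples, at most one solution in $L^2(r\,dx)$ near $b$). $H_0$ is a self-adjoint operator in $L^2((a,b),r\,dx)$ associated with $\tau_0$ (separated boundary conditions); the essential spectrum of $\tau_0$ means that of $H_0$. $\Delta p=\frac1{p_0}-\frac1{p_1}$, $\Delta q=q_1-q_0$. Admissibility: a boundary point $E$ of the essential spectrum of $H_0$ is admissible if there are a minimal solution $u_0$ of $(\tau_0-E)u_0=0$ (i.e. a solution with minimal growth) and a second linearly independent solution $v_0$ of $(\tau_0-E)v_0=0$ with Wronskian $W(u_0,v_0)=u_0\,p_0v_0'-p_0u_0'\,v_0=1$ such that, as $x\to\infty$, $$\begin{pmatrix}u_0\\ p_0u_0'\end{pmatrix}=O(\alpha),\qquad \begin{pmatrix}v_0\\ p_0v_0'\end{pmatrix}-\beta\begin{pmatrix}u_0\\ p_0u_0'\end{pmatrix}=o(\alpha\beta)$$ for some weight functions $\alpha>0$ and $\beta$, with either $\beta>0$ everywhere or $\beta<0$ everywhere, where $\beta$ is absolutely continuous and $\rho=\frac{\beta'}{\beta}>0$ satisfies $\rho(x)=o(1)$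 and $\frac1\ell\int_0^\ell|\rho(x+t)-\rho(x)|\,dt=o(\rho(x))$ for every $\ell>0$. Relative oscillation: for a nontrivial solution $u_j$ of $\tau_ju_j=Eu_j$ define the Prüfer angle $\theta_j$ as the continuous function with $u_j=\rho_j\sin\theta_j$, $p_ju_j'=\rho_j\cos\theta_j$, $\rho_j>0$. Put $\Delta_{1,0}=\theta_1-\theta_0$ and $\#_{(c,d)}(u_0,u_1)=\lceil\Delta_{1,0}(d)/\pi\rceil-\lfloor\Delta_{1,0}(c)/\pi\rfloor-1$. Let $\underline{\#}(u_0,u_1)$ and $\overline{\#}(u_0,u_1)$ be the $\liminf$ and $\limsup$ of $\#_{(c,d)}(u_0,u_1)$ as $d\uparrow b$, $c\downarrow a$. $\tau_1-E$ is relatively nonoscillatory with respect to $\tau_0-E$ if $\underline{\#}(u_0,u_1)$ and $\overline{\#}(u_0,u_1)$ are finite for all nontrivial solutions $\tau_ju_j=Eu_j$, $j=0,1$, and relatively oscillatory if one of them is infinite for some such solutions (this does not depend on the solutions chosen). (In this paragraph $u_0$ denotes an arbitrary solution of $\tau_0u_0=Eu_0$.) *)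

(* Defs.v *)
From mathcomp Require Import all_boot all_order all_algebra.
From mathcomp.real_closed Require Import complex.
From mathcomp Require Import all_classical all_reals all_analysis.

Set Implicit Arguments.
Unset Strict Implicit.
Unset Printing Implicit Defensive.

Import Order.TTheory GRing.Theory Num.Theory.
Import numFieldNormedType.Exports.

Local Open Scope classical_set_scope.
Local Open Scope ring_scope.

Section Calculus.
Context {R : realType}.
Implicit Types (a x y : R) (f g : R -> R) (u : R -> R[i]).
Let mu := @lebesgue_measure R.

Definition halfline a : set R := `]a, +oo[%classic.

(* [f] is absolutely continuous on every compact subinterval of (a, oo), in
   the form "indefinite integral of a locally integrable function". *)
Definition abs_cont_loc a f : Prop :=
  exists2 g, locally_integrable (halfline a) g &
    forall x y, a < x -> x <= y ->
      f y - f x = \int[mu]_(t in `[x, y]) g t.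

Definition ae_derivative a f g : Prop :=
  {ae mu, forall x, a < x -> is_derive x 1 f (g x)}.

(* A complex-valued function of a real variable is handled through its real
   and imaginary parts. *)
Definition abs_cont_locC a u : Prop :=
  abs_cont_loc a (fun x => complex.Re (u x)) /\
  abs_cont_loc a (fun x => complex.Im (u x)).

Definition ae_derivativeC a u (du : R -> R[i]) : Prop :=
  ae_derivative a (fun x => complex.Re (u x)) (fun x => complex.Re (du x)) /\
  ae_derivative a (fun x => complex.Im (u x)) (fun x => complex.Im (du x)).

(* The filter "almost every x, as x --> +oo"; needed because coefficients and
   derivatives of absolutely continuous functions are only defined a.e. *)
Definition ae_pinfty : set_system R :=
  [set A | exists M : R, {ae mu, forall x, M < x -> A x}].

Global Instance ae_pinfty_filter : Filter ae_pinfty.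
Proof.
have aeF := ae_filter_ringOfSetsType mu.
split.
- by exists 0; apply: aeW.
- move=> A B [M AM] [N BN]; exists (Num.max M N).
  apply: filterS2 AM BN => x Ax Bx; rewrite gt_max => /andP[Mx Nx].
  by split; [exact: Ax|exact: Bx].
- move=> A B AB [M AM]; exists M.
  by apply: filterS AM => x Ax Mx; exact/AB/Ax.
Qed.

(* Needed for the Landau notations at these filters. *)
Canonical ae_pinfty_filter_on := FilterType ae_pinfty ae_pinfty_filter.
Canonical pinfty_filter_on :=
  FilterType (pinfty_nbhs R) (@proper_pinfty_nbhs R).

End Calculus.

(* The differential expression tau = (1/r) (- d/dx p d/dx + q) on (a, oo). *)
Section SturmLiouville.
Context {R : realType}.
Implicit Types (a E phi : R) (p q r u pu v pv : R -> R) (z : R[i]).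
Implicit Types (f g pf : R -> R[i]).
Let mu := @lebesgue_measure R.

(* Coefficients are classes modulo null sets, so positivity is a.e. *)
Definition sl_coefficients a p q r : Prop :=
  [/\ locally_integrable (halfline a) (fun x => (p x)^-1),
      locally_integrable (halfline a) q,
      locally_integrable (halfline a) r,
      {ae mu, forall x, a < x -> 0 < p x} &
      {ae mu, forall x, a < x -> 0 < r x}].

Definition regular_at_left a p q r : Prop :=
  exists2 c, a < c &
    [/\ mu.-integrable `]a, c[%classic (fun x => ((p x)^-1)%:E),
        mu.-integrable `]a, c[%classic (fun x => (q x)%:E) &
        mu.-integrable `]a, c[%classic (fun x => (r x)%:E)].

(* Everywhere below a function comes with its quasi-derivative: [pu] is the
   absolutely continuous representative of p u'. *)
Definition solution a p q r E u pu : Prop :=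
  [/\ abs_cont_loc a u, abs_cont_loc a pu,
      ae_derivative a u (fun x => pu x / p x) &
      ae_derivative a pu (fun x => (q x - E * r x) * u x)].

Definition nontrivial a u : Prop := exists2 x, a < x & u x != 0.

Definition nontrivial_solution a p q r E u pu : Prop :=
  solution a p q r E u pu /\ nontrivial a u.

(* tau f = g, for complex-valued f and g. *)
Definition tau_eq a p q r f pf g : Prop :=
  [/\ abs_cont_locC a f, abs_cont_locC a pf,
      ae_derivativeC a f (fun x => pf x / (p x)%:C%C) &
      ae_derivativeC a pf (fun x => (q x)%:C%C * f x - (r x)%:C%C * g x)].

Definition L2norm2 a r f : \bar R :=
  (\int[mu]_(x in halfline a)
     (((complex.Re (f x)) ^+ 2 + (complex.Im (f x)) ^+ 2) * r x)%:E)%E.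

(* Membership in L^2((a, oo), r dx). *)
Definition L2 a r f : Prop :=
  [/\ measurable_fun (halfline a) (fun x => complex.Re (f x)),
      measurable_fun (halfline a) (fun x => complex.Im (f x)) &
      (L2norm2 a r f < +oo)%E].

Definition limit_point_pinfty a p q r : Prop :=
  forall z f1 pf1 f2 pf2,
    tau_eq a p q r f1 pf1 (fun x => z * f1 x) ->
    tau_eq a p q r f2 pf2 (fun x => z * f2 x) ->
    (exists2 c, a < c & L2 c r f1) ->
    (exists2 c, a < c & L2 c r f2) ->
    exists c1 c2 : R[i], (c1, c2) != (0, 0) /\
      forall x, a < x -> c1 * f1 x + c2 * f2 x = 0.

(* Graph of the self-adjoint realization of tau (a regular, oo limit point)
   with boundary condition cos(phi) f(a) - sin(phi) (p f')(a) = 0. *)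
Definition sl_operator a p q r phi f g : Prop :=
  [/\ L2 a r f, L2 a r g &
    exists pf, [/\ tau_eq a p q r f pf g,
      (fun x => cos phi * complex.Re (f x) - sin phi * complex.Re (pf x))
        @ a^'+ --> (0 : R) &
      (fun x => cos phi * complex.Im (f x) - sin phi * complex.Im (pf x))
        @ a^'+ --> (0 : R)]].

(* Spectral notions for an operator in L^2((a, oo), r dx) given by its graph
   [H], where H f g is invariant under a.e. modification of g. *)
Section Spectrum.
Variables (a : R) (r : R -> R) (H : (R -> R[i]) -> (R -> R[i]) -> Prop).

(* H - z maps the domain bijectively onto L^2, with bounded inverse. *)
Definition resolvent_set : set R[i] := [set z |
  (forall h, L2 a r h -> exists f, H f (fun x => h x + z * f x)) /\
  exists C : R, forall f g, H f g ->
    (L2norm2 a r f <= C%:E * L2norm2 a r (fun x => g x - z * f x)%R)%E].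

Definition spectrum : set R[i] := ~` resolvent_set.

Definition eigenfunction z f : Prop := H f (fun x => z * f x).

Definition eigenvalue z : Prop :=
  exists2 f, eigenfunction z f & exists2 x, a < x & f x != 0.

Definition finite_multiplicity z : Prop :=
  exists (n : nat) (e : 'I_n -> R -> R[i]),
    (forall k, eigenfunction z (e k)) /\
    forall f, eigenfunction z f -> exists c : 'I_n -> R[i],
      forall x, a < x -> f x = \sum_(k < n) c k * e k x.

Definition isolated_in (S : set R[i]) z : Prop :=
  S z /\ exists2 eps : R, 0 < eps &
    forall w, S w -> `|w - z| < eps%:C%C -> w = z.

Definition discrete_spectrum : set R[i] := [set z |
  [/\ isolated_in spectrum z, eigenvalue z & finite_multiplicity z]].

Definition essential_spectrum : set R[i] := spectrum `\` discrete_spectrum.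

(* Boundary in R of the essential spectrum of a self-adjoint operator. *)
Definition ess_spectrum_boundary (E : R) : Prop :=
  let S : set R := [set l | essential_spectrum l%:C%C] in
  closure S E /\ ~ S° E.

End Spectrum.

(* Minimal growth at +oo, growth being that of the vector (u, p u'). *)
Definition minimal_solution a p q r E u pu : Prop :=
  nontrivial_solution a p q r E u pu /\
  forall v pv, nontrivial_solution a p q r E v pv ->
    (fun x => (u x, pu x)) =O_+oo (fun x => (v x, pv x)).

Definition wronskian u pu v pv : R -> R :=
  fun x => u x * pv x - pu x * v x.

(* [beta'] is a version of the a.e. derivative of [beta]. *)
Definition admissible a p q r phi E u pu v pv
    (alpha beta beta' : R -> R) : Prop :=
  let rho := fun x => beta' x / beta x in
  [/\ ess_spectrum_boundary a r (sl_operator a p q r phi) E,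
      [/\ minimal_solution a p q r E u pu,
          solution a p q r E v pv &
          forall x, a < x -> wronskian u pu v pv x = 1],
      [/\ forall x, a < x -> 0 < alpha x,
          (forall x, a < x -> 0 < beta x) \/ (forall x, a < x -> beta x < 0),
          abs_cont_loc a beta,
          measurable_fun (halfline a) beta' &
          ae_derivative a beta beta'],
      (fun x => (u x, pu x)) =O_+oo alpha /\
      (fun x => (v x - beta x * u x, pv x - beta x * pu x))
        =o_+oo (fun x => alpha x * beta x) &
      [/\ {ae mu, forall x, a < x -> 0 < rho x},
          rho x @[x --> ae_pinfty] --> (0 : R) &
          forall l : R, 0 < l ->
            (fun x => l^-1 * \int[mu]_(t in `[0, l]) `|rho (x + t) - rho x|)
              =o_ae_pinfty rho]].

Definition prufer_angle a u pu (theta : R -> R) : Prop :=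
  (forall x, a < x -> {for x, continuous theta}) /\
  exists rad : R -> R, forall x, a < x ->
    [/\ 0 < rad x, u x = rad x * sin (theta x) & pu x = rad x * cos (theta x)].

(* The Prüfer angles are determined up to multiples of 2 pi; the count does
   not depend on this choice. *)
Definition rel_count (theta0 theta1 : R -> R) (cd : R * R) : int :=
  let Delta x := theta1 x - theta0 x in
  Num.ceil (Delta cd.2 / pi) - Num.floor (Delta cd.1 / pi) - 1.

Definition rel_count_inf a theta0 theta1 : \bar R :=
  limf_einf (fun cd => ((rel_count theta0 theta1 cd)%:~R)%:E)
            (filter_prod a^'+ +oo).

Definition rel_count_sup a theta0 theta1 : \bar R :=
  limf_esup (fun cd => ((rel_count theta0 theta1 cd)%:~R)%:E)
            (filter_prod a^'+ +oo).

Definition rel_nonoscillatory a p0 q0 p1 q1 r E : Prop :=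
  forall u0 pu0 u1 pu1 theta0 theta1,
    nontrivial_solution a p0 q0 r E u0 pu0 ->
    nontrivial_solution a p1 q1 r E u1 pu1 ->
    prufer_angle a u0 pu0 theta0 -> prufer_angle a u1 pu1 theta1 ->
    rel_count_inf a theta0 theta1 \is a fin_num /\
    rel_count_sup a theta0 theta1 \is a fin_num.

Definition rel_oscillatory a p0 q0 p1 q1 r E : Prop :=
  exists u0 pu0 u1 pu1 theta0 theta1,
    [/\ nontrivial_solution a p0 q0 r E u0 pu0,
        nontrivial_solution a p1 q1 r E u1 pu1,
        prufer_angle a u0 pu0 theta0, prufer_angle a u1 pu1 theta1 &
        rel_count_inf a theta0 theta1 \isn't a fin_num \/
        rel_count_sup a theta0 theta1 \isn't a fin_num].

(* (1/l) \int_x^{x+l} f *)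
Definition window_mean (f : R -> R) (l x : R) : R :=
  l^-1 * \int[mu]_(t in `[x, x + l]) f t.

Definition inf_limsup_mean (f : R -> R) : \bar R :=
  ereal_inf [set limf_esup (fun x => (window_mean f l x)%:E) +oo
            | l in [set l : R | 0 < l]].

Definition sup_liminf_mean (f : R -> R) : \bar R :=
  ereal_sup [set limf_einf (fun x => (window_mean f l x)%:E) +oo
            | l in [set l : R | 0 < l]].

End SturmLiouville.

(* Main.v *)
From HB Require Import structures.
Require Import Defs.
From mathcomp Require Import all_boot all_order all_algebra.
From mathcomp.real_closed Require Import complex.
From mathcomp Require Import all_classical all_reals all_analysis.
From mathcomp Require Import measurable_realfun ring lra.

Set Implicit Arguments.
Unset Strict Implicit.
Unset Printing Implicit Defensive.

Import Order.TTheory GRing.Theory Num.Theory.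
Import numFieldNormedType.Exports.

Local Open Scope classical_set_scope.
Local Open Scope ring_scope.

(** Variation of constants writes a solution of tau_1 u = E u as
    (u1, p1 u1') = A (u0, p0 u0') + B (v0, p0 v0'), where A and B are, up to
    sign, its Wronskians with v0 and u0.  Only the perturbation (Dq, Dp) makes
    A and B move.  Since v0 behaves like beta u0, the natural unknowns are
    y = A + beta B and z = beta B.  With rho = beta'/beta and F the integrand
    of the theorem, admissibility and the growth bounds on Dq and Dp turn the
    equations for A and B into
      y' = rho (z + o(1) y + o(1) z),   z' = rho (z + F y + o(1) z),
    that is y'' = y' + F y in the time log |beta|.  The characteristic
    exponents are 1/2 +- sqrt (1/4 + F), so that -1/4 separates rotation
    from no rotation, at least for constant F.

    The angle psi of (y, z) makes this precise for means of F: by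
    [angle_speed_identity] and [angle_speed_error],
      psi' = rho (sin psi cos psi - sin^2 psi + F cos^2 psi + o(1)).
    As rho tends to 0 and is almost constant on windows of a given length,
    psi hardly moves during one window, and F may be replaced there by its
    window mean ([window_step]).  The field
    sin cos - sin^2 + f cos^2 = - (sin - cos / 2)^2 + (f + 1/4) cos^2 is
    negative definite for f < -1/4: if the means stay below -1/4, psi decreases
    by a fixed proportion of the integral of rho
    ([slow_motion_decreasing]).  If they stay above -1/4, psi cannot
    move down through the direction of slope 1/2, nor up through the vertical
    direction, hence is bounded ([slow_motion_bounded]).

    Two facts connect psi with the statement.  First, continuous angles of two
    vectors that are never antiparallel differ by a bounded function
    ([angle_compare]); two applications compare psi, up to orientation, with the
    difference of the Pruefer angles of arbitrary solutions
    ([relative_angle]), and near the regular endpoint Pruefer angles are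
    bounded ([prufer_bounded_left]).  So the relative count is bounded if
    psi is, and unbounded if psi is unbounded.  Second, the integral of rho
    diverges in the oscillatory case: otherwise beta has a finite limit b, the
    solution v0 - b u0 is o(alpha), by minimality so is u0, and then F tends to
    0, which contradicts means below -1/4.

    Solutions are only absolutely continuous, so all differential calculus is
    done with indefinite integrals; the product and chain rules
    ([primM], [prim_comp]) follow from a local-to-global principle
    ([local_to_global]) instead of pointwise differentiation.  Solutions of
    tau_1 u = E u are produced by Picard iteration
    ([linear_system_solution]). *)

(** * Integrals over compact intervals *)

Section IntervalIntegral.
Context {R : realType}.
Implicit Types (a b x y z s t c e : R) (f g h k : R -> R).
Local Notation mu := (@lebesgue_measure R).

(** Lets typeclass search combine a.e. statements. *)
#[export] Instance ae_filter_mu : Filter (almost_everywhere mu) :=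
  ae_filter_ringOfSetsType mu.

Definition itv_integrable x y f := mu.-integrable `[x, y] (EFin \o f).

Lemma intblS x y s t f : x <= s -> t <= y -> itv_integrable x y f -> itv_integrable s t f.
Proof.
move=> xs ty; apply: integrableS => //.
by move=> r /=; rewrite !in_itv/= => /andP[sr rt]; apply/andP; split; lra.
Qed.

Lemma intbl_meas x y f : itv_integrable x y f -> measurable_fun `[x, y] f.
Proof. by move=> /measurable_int/measurable_EFinP. Qed.

Lemma intblD x y f g : itv_integrable x y f -> itv_integrable x y g -> itv_integrable x y (fun t => f t + g t).
Proof. by move=> fi gi; exact: (integrableD _ fi gi). Qed.

Lemma intblN x y f : itv_integrable x y f -> itv_integrable x y (fun t => - f t).
Proof.
move=> fi; rewrite /itv_integrable.
have -> : EFin \o (fun t => - f t) = (-%E \o (EFin \o f))%E by [].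
exact: integrableN.
Qed.

Lemma intblB x y f g : itv_integrable x y f -> itv_integrable x y g -> itv_integrable x y (fun t => f t - g t).
Proof. by move=> fi gi; apply: intblD => //; apply: intblN. Qed.

Lemma intblZ x y c f : itv_integrable x y f -> itv_integrable x y (fun t => c * f t).
Proof.
move=> fi; rewrite /itv_integrable.
have -> : EFin \o (fun t => c * f t) = (fun t => c%:E * (EFin \o f) t)%E by [].
exact: integrableZl.
Qed.

Lemma intbl_norm x y f : itv_integrable x y f -> itv_integrable x y (fun t => `|f t|).
Proof. by move=> fi; exact: integrable_norm. Qed.

Lemma intbl_bound x y f c : measurable_fun `[x, y] f ->
  (forall t, x <= t <= y -> `|f t| <= c) -> itv_integrable x y f.
Proof.
move=> mf fc; apply: measurable_bounded_integrable => //.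
  rewrite /= lebesgue_measure_itv/=; case: ifP => _ //.
  by rewrite -EFinB ltry.
exists c; split; first by rewrite num_real.
by move=> e ce t /=; rewrite in_itv/= => /fc/le_trans; apply; exact: ltW.
Qed.

Lemma intbl_cst x y c : itv_integrable x y (fun=> c).
Proof. exact: (@intbl_bound _ _ _ `|c|). Qed.

Lemma intblM_bound x y f g c : measurable_fun `[x, y] f ->
  (forall t, x <= t <= y -> `|f t| <= c) ->
  itv_integrable x y g -> itv_integrable x y (fun t => f t * g t).
Proof.
move=> mf fc gi; rewrite /itv_integrable.
have -> : EFin \o (fun t => f t * g t) = ((EFin \o f) \* (EFin \o g))%E by [].
apply: integrableMr => //.
exists c; split; first by rewrite num_real.
by move=> e ce t /=; rewrite in_itv/= => /fc/le_trans; apply; exact: ltW.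
Qed.

Lemma intbl_dom x y f g : measurable_fun `[x, y] f -> itv_integrable x y g ->
  (forall t, x <= t <= y -> `|f t| <= g t) -> itv_integrable x y f.
Proof.
move=> mf gi fg; apply: le_integrable gi => //; first exact/measurable_EFinP.
move=> t /=; rewrite in_itv/= => /fg h.
by rewrite lee_fin; apply: le_trans h _; exact: ler_norm.
Qed.

Local Notation I x y f := (Rintegral mu `[x, y] f).

Lemma int_ae_eq x y f g : itv_integrable x y f -> itv_integrable x y g ->
  {ae mu, forall t, x <= t <= y -> f t = g t} -> I x y f = I x y g.
Proof.
move=> fi gi fg; rewrite /Rintegral; congr fine.
apply: ae_eq_integral => //; [exact: measurable_int fi|exact: measurable_int gi|].
apply: filterS fg => t fgt /=; rewrite in_itv/= => /fgt ->//.
Qed.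

Lemma intbl_ae x y f g : measurable_fun `[x, y] f -> itv_integrable x y g ->
  {ae mu, forall t, x <= t <= y -> f t = g t} -> itv_integrable x y f.
Proof.
move=> mf gi fg; apply/integrableP; split; first exact/measurable_EFinP.
have /integrableP[mg] := gi; apply: le_lt_trans.
apply: ae_ge0_le_integral => //.
- by apply: measurableT_comp => //; exact/measurable_EFinP.
- exact: measurableT_comp.
- by apply: filterS fg => t fgt /=; rewrite in_itv/= => /fgt ->.
Qed.

Lemma intD x y f g : itv_integrable x y f -> itv_integrable x y g ->
  I x y (fun t => f t + g t) = I x y f + I x y g.
Proof. by move=> fi gi; exact: RintegralD. Qed.

Lemma intB x y f g : itv_integrable x y f -> itv_integrable x y g ->
  I x y (fun t => f t - g t) = I x y f - I x y g.
Proof. by move=> fi gi; exact: RintegralB. Qed.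

Lemma intZ x y c f : itv_integrable x y f -> I x y (fun t => c * f t) = c * I x y f.
Proof. by move=> fi; exact: RintegralZl. Qed.

Lemma int_cst x y c : x <= y -> I x y (fun=> c) = c * (y - x).
Proof.
move=> xy; rewrite Rintegral_cst//=; congr (_ * _).
rewrite lebesgue_measure_itv/= lte_fin; case: ltP => //= yx.
by have -> : x = y; [apply/le_anti/andP|rewrite subrr].
Qed.

Lemma int_pt x f : I x x f = 0.
Proof. by rewrite set_itv1 Rintegral_set1. Qed.

Lemma int_split x y z f : x <= y -> y <= z -> itv_integrable x z f ->
  I x z f = I x y f + I y z f.
Proof.
move=> xy yz fi.
have := @Rintegral_itvB R f (BLeft x) (BRight z) y fi.
rewrite !bnd_simp => /(_ xy yz).
rewrite Rintegral_itv_obnd_cbnd; last first.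
  apply: integrableS fi => // t /=; rewrite !in_itv/= => /andP[a1 a2].
  by apply/andP; split => //; lra.
by move=> <-; ring.
Qed.

(** Comparing [f] with the pointwise minimum of [f] and [g], which is a.e. equal to [f],
    reduces the a.e. statement to the everywhere one. *)
Lemma le_int_ae x y f g : itv_integrable x y f -> itv_integrable x y g ->
  {ae mu, forall t, x <= t <= y -> f t <= g t} -> I x y f <= I x y g.
Proof.
move=> fi gi fg.
have mi : itv_integrable x y (fun t => Num.min (f t) (g t)).
  apply: (@intbl_dom _ _ _ (fun t => `|f t| + `|g t|)).
  - by apply: measurable_minr; exact: intbl_meas.
  - by apply: intblD; exact: intbl_norm.
  - move=> t _; rewrite minEle; case: ifP => _; first by rewrite lerDl.
    by rewrite lerDr.
rewrite (@int_ae_eq _ _ f (fun t => Num.min (f t) (g t)))//.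
  by apply: le_Rintegral => // t _; rewrite ge_min lexx orbT.
by apply: filterS fg => t h /h fgt; rewrite min_l.
Qed.

Lemma le_int x y f g : itv_integrable x y f -> itv_integrable x y g ->
  (forall t, x <= t <= y -> f t <= g t) -> I x y f <= I x y g.
Proof. by move=> fi gi fg; apply: le_int_ae => //; exact: aeW. Qed.

Lemma norm_int_le_ae x y f g : itv_integrable x y f -> itv_integrable x y g ->
  {ae mu, forall t, x <= t <= y -> `|f t| <= g t} -> `|I x y f| <= I x y g.
Proof.
move=> fi gi fg; apply: le_trans (le_normr_Rintegral _ fi) _ => //.
by apply: le_int_ae => //; exact: intbl_norm.
Qed.

Lemma norm_int_le x y f g : itv_integrable x y f -> itv_integrable x y g ->
  (forall t, x <= t <= y -> `|f t| <= g t) -> `|I x y f| <= I x y g.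
Proof. by move=> fi gi fg; apply: norm_int_le_ae => //; exact: aeW. Qed.

Lemma int_ge0 x y f : (forall t, x <= t <= y -> 0 <= f t) -> 0 <= I x y f.
Proof. by move=> f0; apply: Rintegral_ge0 => t /=; rewrite in_itv/=; exact: f0. Qed.

Lemma int_mono x y s t f : x <= s -> s <= t -> t <= y -> itv_integrable x y f ->
  (forall r, x <= r <= y -> 0 <= f r) -> I s t f <= I x y f.
Proof.
move=> xs st ty fi f0.
rewrite (@int_split x s y)//; last lra.
rewrite (@int_split s t y)//; last by apply: intblS fi; lra.
have h1 : 0 <= I x s f by apply: int_ge0 => r hr; apply: f0; lra.
have h2 : 0 <= I t y f by apply: int_ge0 => r hr; apply: f0; lra.
lra.
Qed.

End IntervalIntegral.

Notation "'intg' x y f" := (Rintegral (@lebesgue_measure _) `[x, y] f)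
  (at level 10, x, y, f at level 9).

(** * Locally absolutely continuous functions in integral form *)

Section Primitives.
Context {R : realType}.
Implicit Types (a b x y z s t c d e : R) (f g h k F G H : R -> R).
Local Notation mu := (@lebesgue_measure R).

Definition loc_integrable a g := forall x y, a < x -> itv_integrable x y g.

Definition continuous_after a f := forall x, a < x -> {for x, continuous f}.

(** [f] is locally absolutely continuous on (a, oo) with derivative [g] a.e., stated
    with integrals only.  Unlike an a.e. derivative, a density determines [f] up
    to a constant. *)
Definition primitive a f g := loc_integrable a g /\
  forall x y, a < x -> x <= y -> f y - f x = intg x y g.

Lemma lint_of_loc a g : locally_integrable (halfline a) g -> loc_integrable a g.
Proof.
move=> [mg _ gK] x y ax; apply/integrableP.
have xyD : `[x, y] `<=` halfline a.
  move=> t /=; rewrite /halfline /= !in_itv/= andbT => /andP[xt _].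
  exact: lt_le_trans xt.
split; last by apply: gK => //; exact: segment_compact.
apply/measurable_EFinP; apply: measurable_funS mg => //.
exact: measurable_itv.
Qed.

Lemma halfline_bigcup a :
  halfline a = \bigcup_n `[a + n.+1%:R^-1, a + n.+1%:R]%classic.
Proof.
apply/seteqP; split => x /=; rewrite /halfline /= in_itv/= ?andbT.
  move=> ax; have xa : 0 < x - a by rewrite subr_gt0.
  pose m := maxn (Num.truncn (x - a)) (Num.truncn (x - a)^-1).
  exists m => //; rewrite /= in_itv/=.
  have h1 : x - a < m.+1%:R.
    apply: lt_le_trans (truncnS_gt _) _.
    by rewrite ler_nat ltnS leq_maxl.
  have h2 : (x - a)^-1 < m.+1%:R.
    apply: lt_le_trans (truncnS_gt _) _.
    by rewrite ler_nat ltnS leq_maxr.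
  apply/andP; split; last lra.
  by rewrite -lerBrDl invf_ple ?posrE//; exact: ltW.
move=> [n _ /=]; rewrite in_itv/= => /andP[h _]; apply: lt_le_trans h.
by rewrite ltrDl invr_gt0.
Qed.

Lemma lint_meas a g : loc_integrable a g -> measurable_fun (halfline a) g.
Proof.
move=> lg; rewrite halfline_bigcup; apply/measurable_fun_bigcup => // n.
by apply: intbl_meas; apply: lg; rewrite ltrDl invr_gt0.
Qed.

(** A compact subset of (a, oo) stays away from [a], because [1 / (x - a)] is bounded
    on it; hence it lies in a compact interval. *)
Lemma loc_of_lint a g : loc_integrable a g -> locally_integrable (halfline a) g.
Proof.
move=> lg; split; [exact: lint_meas|exact: interval_open|].
move=> K KD cK.
have [->|/set0P[k0 Kk0]] := eqVneq K set0.
  by rewrite integral_set0.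
have cinv : compact ((fun x => (x - a)^-1) @` K).
  apply: continuous_compact => //; apply: continuous_in_subspaceT => x.
  rewrite inE => /KD; rewrite /halfline /= in_itv/= andbT => ax.
  have : {for x, continuous (fun t => t - a)}.
    by apply: continuousB; [exact: cvg_id|exact: cvg_cst].
  by apply: continuousV; rewrite subr_eq0 gt_eqF.
have [M [_ KM]] := compact_bounded cinv.
have [N [_ KN]] := compact_bounded cK.
have M1 : 0 < `|M| + 1 by rewrite ltr_wpDl.
have hM x : K x -> a + (`|M| + 1)^-1 <= x.
  move=> Kx; have := KD _ Kx; rewrite /halfline /= in_itv/= andbT => ax.
  have xa : 0 < x - a by rewrite subr_gt0.
  have hh : M < `|M| + 1 -> `|(x - a)^-1| <= `|M| + 1.
    by move=> /KM; apply; exists x.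
  have xi : 0 <= (x - a)^-1 by rewrite invr_ge0 ltW.
  rewrite (ger0_norm xi) in hh.
  rewrite -lerBrDl invf_ple ?posrE//.
  by apply: hh; rewrite ltr_pwDr// ler_norm.
have hN x : K x -> x <= `|N| + 1.
  move=> Kx; apply: le_trans (ler_norm _) _; apply: KN => //.
  by rewrite ltr_pwDr// ler_norm.
have mg := lint_meas lg.
have axM : a < a + (`|M| + 1)^-1 by rewrite ltrDl invr_gt0.
have /integrableP[mi] := lg (a + (`|M| + 1)^-1) (`|N| + 1) axM.
apply: le_lt_trans.
apply: ge0_subset_integral => //; first exact: compact_measurable.
  by do 2 apply: measurableT_comp => //; exact/measurable_EFinP.
by move=> x Kx /=; rewrite in_itv/= hM ?hN.
Qed.

Lemma lintD a f g : loc_integrable a f -> loc_integrable a g -> loc_integrable a (fun t => f t + g t).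
Proof. by move=> lf lg x y ax; apply: intblD; [exact: lf|exact: lg]. Qed.

Lemma lintN a f : loc_integrable a f -> loc_integrable a (fun t => - f t).
Proof. by move=> lf x y ax; apply: intblN; exact: lf. Qed.

Lemma lintB a f g : loc_integrable a f -> loc_integrable a g -> loc_integrable a (fun t => f t - g t).
Proof. by move=> lf lg; apply: lintD => //; exact: lintN. Qed.

Lemma lintZ a c f : loc_integrable a f -> loc_integrable a (fun t => c * f t).
Proof. by move=> lf x y ax; apply: intblZ; exact: lf. Qed.

Lemma lint_norm a f : loc_integrable a f -> loc_integrable a (fun t => `|f t|).
Proof. by move=> lf x y ax; apply: intbl_norm; exact: lf. Qed.

Lemma cont_within a f x y : continuous_after a f -> a < x -> {within `[x, y], continuous f}.
Proof.
move=> cf ax; apply: continuous_in_subspaceT => t; rewrite inE/= in_itv/=.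
by move=> /andP[xt _]; apply: cf; exact: lt_le_trans xt.
Qed.

Lemma cont_bound a f x y : continuous_after a f -> a < x ->
  exists2 c, 0 <= c & forall t, x <= t <= y -> `|f t| <= c.
Proof.
move=> cf ax.
have cK : compact (f @` `[x, y]).
  by apply: continuous_compact; [exact: cont_within ax|exact: segment_compact].
have [M [_ KM]] := compact_bounded cK.
exists (`|M| + 1); first by rewrite addr_ge0.
move=> t xty; apply: KM; first by rewrite ltr_pwDr// ler_norm.
by exists t.
Qed.

Lemma cont_meas a f x y : continuous_after a f -> a < x -> measurable_fun `[x, y] f.
Proof.
move=> cf ax; apply: subspace_continuous_measurable_fun => //.
exact: cont_within ax.
Qed.

Lemma lint_cont a f : continuous_after a f -> loc_integrable a f.
Proof.
move=> cf x y ax; have [c _ fc] := cont_bound y cf ax.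
by apply: intbl_bound fc => //; exact: cont_meas ax.
Qed.

Lemma lintM a f g : continuous_after a f -> loc_integrable a g -> loc_integrable a (fun t => f t * g t).
Proof.
move=> cf lg x y ax; have [c _ fc] := cont_bound y cf ax.
by apply: intblM_bound fc _ => //; [exact: cont_meas ax|exact: lg].
Qed.

Lemma lint_ae a f g : measurable_fun (halfline a) f -> loc_integrable a g ->
  {ae mu, forall t, a < t -> f t = g t} -> loc_integrable a f.
Proof.
move=> mf lg fg x y ax; apply: (@intbl_ae _ _ _ f g) => //.
- apply: measurable_funS mf => //; first exact: measurable_itv.
  move=> t /=; rewrite /halfline /= !in_itv/= andbT => /andP[xt _].
  exact: lt_le_trans xt.
- exact: lg.
- apply: filterS fg => t h /andP[xt _]; apply: h; exact: lt_le_trans xt.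
Qed.

Lemma contD a f g : continuous_after a f -> continuous_after a g -> continuous_after a (fun t => f t + g t).
Proof. by move=> cf cg x ax; apply: continuousD; [exact: cf|exact: cg]. Qed.
Lemma contN a f : continuous_after a f -> continuous_after a (fun t => - f t).
Proof. by move=> cf x ax; apply: continuousN; exact: cf. Qed.
Lemma contB a f g : continuous_after a f -> continuous_after a g -> continuous_after a (fun t => f t - g t).
Proof. by move=> cf cg; apply: contD => //; exact: contN. Qed.
Lemma contM a f g : continuous_after a f -> continuous_after a g -> continuous_after a (fun t => f t * g t).
Proof. by move=> cf cg x ax; apply: continuousM; [exact: cf|exact: cg]. Qed.
Lemma contV a f : continuous_after a f -> (forall x, a < x -> f x != 0) ->
  continuous_after a (fun t => (f t)^-1).
Proof. by move=> cf f0 x ax; apply: continuousV; [exact: f0|exact: cf]. Qed.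

Lemma cont_osc a f x e : continuous_after a f -> a < x -> 0 < e ->
  exists2 d, 0 < d & forall s t, x - d < s < x + d -> x - d < t < x + d ->
    `|f s - f t| <= e.
Proof.
move=> cf ax e0; have /cvgrPdist_le/(_ (e / 2)) := cf x ax.
rewrite divr_gt0// => /(_ isT) /nbhs_ballP[d /= d0 fd].
exists d => // s t hs ht.
have h r : x - d < r < x + d -> `|f x - f r| <= e / 2.
  by move=> hr; apply: fd; rewrite /ball/= ltr_distlC.
have -> : f s - f t = (f x - f t) - (f x - f s) by ring.
apply: le_trans (ler_normB _ _) _.
by rewrite (splitr e) lerD// h.
Qed.

Lemma prim_lint a f g : primitive a f g -> loc_integrable a g. Proof. by case. Qed.

Lemma prim_cont a f g : primitive a f g -> continuous_after a f.
Proof.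
move=> [lg fg] x ax.
pose x0 := (a + x) / 2.
have ax0 : a < x0 by rewrite /x0; lra.
have x0x : x0 < x by rewrite /x0; lra.
have x01 : x0 < x + 1 by lra.
have := parameterized_integral_continuous (ltW x01) (lg x0 (x + 1) ax0).
move=> /(continuous_within_itvP _ x01)[+ _ _].
have xin : x \in `]x0, x + 1[ by rewrite in_itv/= x0x ltrDl ltr01.
move=> /(_ x xin) cx.
have : {for x, continuous (fun t => f x0 + parameterized_integral mu x0 t g)}.
  by apply: continuousD => //; exact: cvg_cst.
move=> cx1.
have e : \forall t \near x, f x0 + parameterized_integral mu x0 t g = f t.
  near=> t; have x0t : x0 <= t.
    by apply: ltW; near: t; exact: lt_nbhsr.
  by rewrite /parameterized_integral -fg//; ring.
rewrite /prop_for /continuous_at -(nbhs_singleton e).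
exact: (cvg_trans (near_eq_cvg e) cx1).
Unshelve. all: by end_near. Qed.

Lemma prim_ext a f g h : primitive a f g -> (forall x, a < x -> g x = h x) -> primitive a f h.
Proof.
move=> [lg fg] gh.
have e x y : a < x -> {in `[x, y]%classic, g =1 h}.
  move=> ax t; rewrite inE/= in_itv/= => /andP[xt _].
  by apply: gh; exact: lt_le_trans xt.
split.
  move=> x y ax; apply: eq_integrable (lg x y ax) => // t /(e x y ax)/= ->//.
move=> x y ax xy; rewrite (fg x y ax xy); apply: eq_Rintegral; exact: e.
Qed.

Lemma prim_ext_ae a f g h : primitive a f g -> loc_integrable a h ->
  {ae mu, forall x, a < x -> g x = h x} -> primitive a f h.
Proof.
move=> [lg fg] lh gh; split => // x y ax xy; rewrite fg//.
apply: int_ae_eq; [exact: lg|exact: lh|].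
by apply: filterS gh => t gh /andP[xt _]; apply: gh; exact: lt_le_trans xt.
Qed.

Lemma prim_extl a f F g : primitive a f g -> (forall x, a < x -> f x = F x) -> primitive a F g.
Proof.
move=> [lg fg] fF; split => // x y ax xy; rewrite -!fF//; first exact: fg.
exact: lt_le_trans xy.
Qed.

Lemma primD a f f' g g' : primitive a f f' -> primitive a g g' ->
  primitive a (fun t => f t + g t) (fun t => f' t + g' t).
Proof.
move=> [lf ff] [lg gg]; split; first exact: lintD.
move=> x y ax xy; rewrite intD; [|exact: lf|exact: lg].
by rewrite -ff// -gg//; ring.
Qed.

Lemma primZ a c f f' : primitive a f f' -> primitive a (fun t => c * f t) (fun t => c * f' t).
Proof.
move=> [lf ff]; split; first exact: lintZ.
by move=> x y ax xy; rewrite intZ ?lf// -mulrBr ff.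
Qed.

Lemma primN a f f' : primitive a f f' -> primitive a (fun t => - f t) (fun t => - f' t).
Proof.
move=> /(primZ (-1)) h.
by apply: (prim_extl (f := fun t => -1 * f t));
  [apply: prim_ext h _|] => x _; rewrite mulN1r.
Qed.

Lemma primB a f f' g g' : primitive a f f' -> primitive a g g' ->
  primitive a (fun t => f t - g t) (fun t => f' t - g' t).
Proof. by move=> pf pg; apply: primD => //; exact: primN. Qed.

Lemma prim_cst a c : primitive a (fun=> c) (fun=> 0).
Proof.
split; first by move=> x y _; exact: intbl_cst.
by move=> x y _ xy; rewrite int_cst// mul0r subrr.
Qed.

Lemma prim0_const a f x y : primitive a f (fun=> 0) -> a < x -> a < y -> f x = f y.
Proof.
move=> [_ ff].
suff h s t : a < s -> s <= t -> f s = f t.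
  by move=> ax ay; case: (leP x y) => [/h->//|/ltW/h->].
by move=> as_ st; apply/esym/eqP; rewrite -subr_eq0 ff// int_cst// mul0r.
Qed.

Lemma lint_prim a g x0 : a < x0 -> loc_integrable a g -> exists2 G, primitive a G g & G x0 = 0.
Proof.
move=> ax0 lg; exists (fun x => intg x0 x g - intg x x0 g); last by rewrite subrr.
have e x y : y <= x -> x != y -> intg x y g = 0.
  move=> yx xy; rewrite set_itv_ge ?Rintegral_set0//.
  by rewrite bnd_simp -ltNge lt_neqAle eq_sym xy.
have e' x y : y <= x -> intg x y g = 0.
  by move=> yx; have [->|/(e _ _ yx)//] := eqVneq x y; rewrite int_pt.
split => // x y ax xy.
have [x0x|xx0] := leP x0 x.
  rewrite (e' x x0)// (e' y x0); last lra.
  rewrite (@int_split _ x0 x y)//; last exact: lg.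
  by ring.
have [x0y|yx0] := leP x0 y.
  rewrite (e' x0 x); last lra.
  rewrite (e' y x0)//; rewrite (@int_split _ x x0 y)//; last exact: lg.
  - by ring.
  - lra.
rewrite (e' x0 x); last lra.
rewrite (e' x0 y); last lra.
rewrite (@int_split _ x y x0)//; last exact: lg.
- by ring.
- lra.
Qed.

(** An increment estimate that holds near each point, for intervals containing that
    point, adds up to an estimate on the whole interval: the supremum of the points up
    to which it holds cannot be interior.  This replaces a mean value theorem for
    functions that are differentiable only a.e. *)
Lemma local_to_global h K c d : c <= d ->
  (forall x, c <= x <= d -> exists2 e, 0 < e & forall s t,
     c <= s -> x - e < s -> s <= x -> x <= t -> t < x + e -> t <= d ->
     `|h t - h s| <= K t - K s) ->
  `|h d - h c| <= K d - K c.
Proof.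
move=> cd loc.
pose A : set R := [set t | c <= t <= d /\ `|h t - h c| <= K t - K c].
have Ac : A c by rewrite /A/= lexx cd !subrr normr0.
have supA : has_sup A.
  by split; [exists c|exists d => t [/andP[]]].
pose m := sup A.
have cm : c <= m by exact: sup_upper_bound.
have md : m <= d by apply: ge_sup; [exists c|move=> t [/andP[]]].
have [e e0 he] : exists2 e, 0 < e & forall s t,
     c <= s -> m - e < s -> s <= m -> m <= t -> t < m + e -> t <= d ->
     `|h t - h s| <= K t - K s by apply: loc; rewrite cm md.
have [s [/andP[cs sd] hs] ms] := sup_adherent e0 supA.
have sm : s <= m by apply: sup_upper_bound => //; split => //; rewrite cs.
have At t : m <= t -> t < m + e -> t <= d -> A t.
  move=> mt te td; split; first by rewrite td (le_trans cm mt).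
  have -> : h t - h c = (h t - h s) + (h s - h c) by ring.
  apply: le_trans (ler_normD _ _) _.
  have := he s t cs ms sm mt te td.
  by move: hs; lra.
have [md'|dm] := ltP m d.
  have [t [mt te td]] : exists t, [/\ m < t, t < m + e & t <= d].
    have [h1|h1] := leP (m + e / 2) d.
      by exists (m + e / 2); split => //; lra.
    by exists d; split => //; lra.
  have : t <= m by apply: sup_upper_bound => //; apply: At => //; exact: ltW.
  lra.
have <- : m = d by apply/le_anti; rewrite md.
by have [] := At m (lexx m) ltac:(by rewrite ltrDl) md.
Qed.

(** To identify a density it is enough to do so up to a small multiple of the integral
    of a fixed [k] near each point.  Products and compositions satisfy this by mere
    continuity of the factors. *)
Lemma prim_local a f g k : loc_integrable a g -> loc_integrable a k -> (forall t, a < t -> 0 <= k t) ->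
  (forall x e, a < x -> 0 < e -> exists2 d, 0 < d & forall s t,
     a < s -> x - d < s -> s <= x -> x <= t -> t < x + d ->
     `|f t - f s - intg s t g| <= e * intg s t k) ->
  primitive a f g.
Proof.
move=> lg lk k0 loc; split => // x y ax xy.
have [G [_ pG] _] := lint_prim ax lg.
have [K [_ pK] _] := lint_prim ax lk.
apply/eqP; rewrite -subr_eq0 -normr_eq0; apply/eqP/le_anti; rewrite normr_ge0 andbT.
have key e : 0 < e -> `|f y - f x - intg x y g| <= e * intg x y k.
  move=> e0; rewrite -pG// -pK//.
  have := @local_to_global (fun t => f t - G t) (fun t => e * K t) x y xy.
  have -> : f y - f x - (G y - G x) = f y - G y - (f x - G x) by ring.
  rewrite mulrBr; apply => z /andP[xz zy].
  have az : a < z by exact: lt_le_trans xz.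
  have [d d0 hd] := loc z e az e0.
  exists d => // s t xs zs sz zt td ty.
  have as_ : a < s by exact: lt_le_trans xs.
  have st : s <= t by exact: le_trans zt.
  have := hd s t as_ zs sz zt td.
  rewrite -pG// -pK// mulrBr.
  by have -> : f t - G t - (f s - G s) = f t - f s - (G t - G s) by ring.
have k1 : 0 <= intg x y k.
  by apply: int_ge0 => t /andP[xt _]; apply: k0; exact: lt_le_trans xt.
apply/ler_addgt0Pr => e e0; rewrite add0r.
have e1 : 0 < e / (intg x y k + 1) by rewrite divr_gt0// ltr_wpDl.
apply: le_trans (key _ e1) _.
rewrite mulrAC ler_pdivrMr ?ltr_wpDl// ler_wpM2l//; first exact: ltW.
by rewrite lerDl.
Qed.

Lemma primM a f f' g g' : primitive a f f' -> primitive a g g' ->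
  primitive a (fun t => f t * g t) (fun t => f' t * g t + f t * g' t).
Proof.
move=> pf pg; have cf := prim_cont pf; have cg := prim_cont pg.
case: pf => lf pf; case: pg => lg pg.
have l1 : loc_integrable a (fun t => f' t * g t).
  by under eq_fun do rewrite mulrC; exact: lintM.
have l2 : loc_integrable a (fun t => f t * g' t) by exact: lintM.
apply: (@prim_local _ _ _ (fun t => `|f' t| + `|g' t|)).
- exact: lintD.
- by apply: lintD; exact: lint_norm.
- by move=> t _; rewrite addr_ge0.
move=> x e ax e0.
have [d1 d10 fd] := cont_osc cf ax e0.
have [d2 d20 gd] := cont_osc cg ax e0.
exists (Num.min d1 d2); first by rewrite lt_min d10.
move=> s t as_ xs sx xt td.
have st : s <= t by exact: le_trans xt.
have hr r : s <= r <= t -> (x - d1 < r < x + d1) /\ (x - d2 < r < x + d2).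
  move: xs td; rewrite !(ltrBlDr, ltrBlDl).
  have : Num.min d1 d2 <= d1 by rewrite ge_min lexx.
  have : Num.min d1 d2 <= d2 by rewrite ge_min lexx orbT.
  by move=> h1 h2 h3 h4 /andP[h5 h6]; split; apply/andP; split; lra.
have -> : f t * g t - f s * g s = (f t - f s) * g t + f s * (g t - g s) by ring.
rewrite pf// pg//.
have i1 := lf s t as_; have i2 := lg s t as_.
have -> : intg s t f' * g t + f s * intg s t g' =
    intg s t (fun r => g t * f' r + f s * g' r).
  by rewrite intD ?intZ// 1?mulrC//; exact: intblZ.
rewrite -intB; last 2 first.
- by apply: intblD; exact: intblZ.
- exact: (lintD l1 l2).
rewrite -intZ; last by apply: intblD; exact: intbl_norm.
apply: norm_int_le.
- by apply: intblB; [apply: intblD; exact: intblZ|exact: (lintD l1 l2)].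
- by apply: intblZ; apply: intblD; exact: intbl_norm.
move=> r hrst; have [hr1 hr2] := hr r hrst.
have [ht1 ht2] := hr t ltac:(by rewrite st lexx).
have [hs1 hs2] := hr s ltac:(by rewrite st lexx).
have -> : g t * f' r + f s * g' r - (f' r * g r + f r * g' r) =
  (g t - g r) * f' r + (f s - f r) * g' r by ring.
apply: le_trans (ler_normD _ _) _; rewrite !normrM mulrDr.
by apply: lerD; apply: ler_wpM2r => //; [exact: gd|exact: fd].
Qed.

Lemma prim_comp a f f' (phi phi' : R -> R) :
  (forall y : R, is_derive y 1 phi (phi' y)) -> continuous phi' ->
  primitive a f f' -> primitive a (fun t => phi (f t)) (fun t => phi' (f t) * f' t).
Proof.
move=> dphi cphi pf; have cf := prim_cont pf; case: pf => lf pf.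
have cphif : continuous_after a (fun t => phi' (f t)).
  by move=> x ax; apply: continuous_comp; [exact: cf|exact: cphi].
have l1 : loc_integrable a (fun t => phi' (f t) * f' t) by exact: lintM.
apply: (@prim_local _ _ _ (fun t => `|f' t|)) => //; first exact: lint_norm.
move=> x e ax e0.
have /cvgrPdist_le/(_ (e / 2)) := cphi (f x).
rewrite divr_gt0// => /(_ isT) /nbhs_ballP[d1 /= d10 hd1].
have d12 : 0 < d1 / 2 by rewrite divr_gt0.
have [d d0 fd] := cont_osc cf ax d12.
exists d => // s t as_ xs sx xt td.
have st : s <= t by exact: le_trans xt.
have hr r : s <= r <= t -> x - d < r < x + d.
  by move=> /andP[h5 h6]; apply/andP; split; lra.
have xx : x - d < x < x + d by apply/andP; split; lra.
have near_fx r : s <= r <= t -> `|f x - f r| < d1.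
  by move=> /hr hr'; apply: le_lt_trans (fd _ _ xx hr') _; lra.
have [c hc ->] : exists2 c, `|f x - c| < d1 &
    phi (f t) - phi (f s) = phi' c * (f t - f s).
  have hft := near_fx t ltac:(by rewrite st lexx).
  have hfs := near_fx s ltac:(by rewrite st lexx).
  have cont_phi y z : {within `[y, z], continuous phi}.
    apply: derivable_within_continuous => w _.
    by have [] := dphi w.
  move: hft hfs; rewrite !ltr_distlC => /andP[ft1 ft2] /andP[fs1 fs2].
  have [fst|fts] := leP (f s) (f t).
    have [c] := MVT_segment fst (fun x _ => dphi x) (@cont_phi _ _).
    rewrite in_itv/= => /andP[h1 h2] ->.
    by exists c => //; rewrite ltr_distlC; apply/andP; split; lra.
  have [c] := MVT_segment (ltW fts) (fun x _ => dphi x) (@cont_phi _ _).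
  rewrite in_itv/= => /andP[h1 h2] e1.
  exists c; first by rewrite ltr_distlC; apply/andP; split; lra.
  by rewrite -opprB e1 -mulrN opprB.
rewrite pf//.
have i1 := lf s t as_.
rewrite -!intZ//; last exact: intbl_norm.
rewrite -intB; [|exact: intblZ|exact: l1].
apply: norm_int_le.
- by apply: intblB; [exact: intblZ|exact: l1].
- by apply: intblZ; exact: intbl_norm.
move=> r hrst; rewrite -mulrBl normrM; apply: ler_wpM2r => //.
have h1 := hd1 c hc.
have h2 := hd1 (f r) (near_fx r hrst).
have -> : phi' c - phi' (f r) =
  (phi' (f x) - phi' (f r)) - (phi' (f x) - phi' c) by ring.
apply: le_trans (ler_normB _ _) _.
by rewrite (splitr e) lerD.
Qed.

Lemma prim_sin a f f' : primitive a f f' -> primitive a (fun t => sin (f t)) (fun t => cos (f t) * f' t).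
Proof. by apply: prim_comp; exact: continuous_cos. Qed.

Lemma prim_cos a f f' : primitive a f f' -> primitive a (fun t => cos (f t)) (fun t => - sin (f t) * f' t).
Proof.
apply: (@prim_comp _ _ _ cos (fun x => - sin x)).
by move=> x; apply: continuousN; exact: continuous_sin.
Qed.

Lemma prim_exp a f f' : primitive a f f' -> primitive a (fun t => expR (f t)) (fun t => expR (f t) * f' t).
Proof. by apply: prim_comp; exact: continuous_expR. Qed.

(** [f * expR (- H)] has density zero, hence is constant. *)
Lemma prim_linear a f h H x y : primitive a H h -> primitive a f (fun t => h t * f t) ->
  a < x -> a < y -> f y = f x * expR (H y - H x).
Proof.
move=> pH pf ax ay.
have pe := prim_exp (primN pH).
have p0 : primitive a (fun t => f t * expR (- H t)) (fun=> 0).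
  by apply: prim_ext (primM pf pe) _ => t _; ring.
have e : f x * expR (- H x) = f y * expR (- H y) := prim0_const p0 ax ay.
by rewrite expRD [expR (H y) * _]mulrC mulrA e -mulrA -expRD addNr expR0 mulr1.
Qed.

End Primitives.

(** * Almost everywhere derivatives and continuous angles *)

Section Derivatives.
Context {R : realType}.
Implicit Types (a b x y z s t c d e : R) (f g h k F G H : R -> R).
Local Notation mu := (@lebesgue_measure R).

Lemma prim_abs_cont a f g : primitive a f g -> abs_cont_loc a f.
Proof. by move=> [lg fg]; exists g => //; exact: loc_of_lint. Qed.

(** Lebesgue differentiation, applied on an exhaustion of (a, oo) by compact intervals. *)
Lemma prim_ae_derivative a f g : primitive a f g -> ae_derivative a f g.
Proof.
move=> [lg fg].
pose l n := a + n.+1%:R^-1; pose u n := a + n.+1%:R.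
pose gn n := g \_ `[l n, u n].
have al n : a < l n by rewrite /l ltrDl invr_gt0.
have locgn n : locally_integrable [set: R] (gn n).
  by apply: integrable_locally => //; exact: lg.
have intgn n y : mu.-integrable [set` Interval (BLeft (l n)) (BRight y)] (EFin \o gn n).
  have : mu.-integrable setT (EFin \o gn n).
    rewrite /gn -restrict_EFin; by apply: (integrable_mkcond _ _).1 => //; apply: lg.
  by apply: integrableS.
have ftc n := @FTC1 R (gn n) (BLeft (l n)) (intgn n) (locgn n).
have {}ftc := ae_foralln ftc.
apply: filterS ftc => x ftc ax.
have : halfline a x by rewrite /halfline /= in_itv/= andbT.
rewrite halfline_bigcup => -[m _]; rewrite /= in_itv/= => /andP[mx xm].
(* one step further in the exhaustion [x] is an interior point *)
pose n := m.+1.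
have lx : l n < x.
  apply: lt_le_trans mx; rewrite /l ltrD2l ltf_pV2 ?posrE// ltr_nat//.
have xu : x < u n.
  by apply: le_lt_trans xm _; rewrite /u ltrD2l ltr_nat.
have [] := ftc n; first by rewrite lte_fin.
set Fn := (fun x => _) => dF.
rewrite derive1E => eF.
have gnx : gn n x = g x by rewrite /gn patchE mem_set//= in_itv/= !ltW.
have dFn : is_derive x 1 Fn (g x) by rewrite -gnx -eF; exact: DeriveDef.
have dFn' : is_derive x 1 (cst (f (l n)) + Fn) (g x).
  by rewrite -[g x]add0r; apply: is_deriveD.
apply: near_eq_is_derive dFn'.
near=> y.
have ly : l n < y by near: y; exact: lt_nbhsr.
have yu : y < u n by near: y; exact: lt_nbhsl.
rewrite -[in RHS](subrK (f (l n)) (f y)) fg ?ltW// /cst fctE addrC; congr (_ + _).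
apply: eq_Rintegral => t; rewrite inE/= in_itv/= => /andP[lt_ ty].
by rewrite /gn patchE mem_set//= in_itv/= lt_ (le_trans ty (ltW yu)).
Unshelve. all: by end_near. Qed.

(** The density that absolute continuity provides and the given a.e. derivative agree
    a.e., so the latter may be integrated. *)
Lemma prim_of_abs_cont a f g : abs_cont_loc a f -> ae_derivative a f g ->
  measurable_fun (halfline a) g -> primitive a f g.
Proof.
move=> [h lh fh] dfg mg.
have ph : primitive a f h by split => //; exact: lint_of_loc.
have dfh := prim_ae_derivative ph.
have gh : {ae mu, forall t, a < t -> g t = h t}.
  apply: filterS2 dfg dfh => t d1 d2 at_.
  have [_ <-] := d1 at_; by have [_ <-] := d2 at_.
apply: prim_ext_ae ph _ _; last by apply: filterS gh => t /[apply].
by apply: lint_ae gh => //; exact: lint_of_loc.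
Qed.

Lemma polar_pt x y : x ^+ 2 + y ^+ 2 != 0 ->
  exists r th, [/\ 0 < r, x = r * cos th & y = r * sin th].
Proof.
move=> n0; pose r := Num.sqrt (x ^+ 2 + y ^+ 2).
have p0 : 0 < x ^+ 2 + y ^+ 2 by rewrite lt_neqAle eq_sym n0 addr_ge0// sqr_ge0.
have r0 : 0 < r by rewrite sqrtr_gt0.
have r2 : r ^+ 2 = x ^+ 2 + y ^+ 2 by rewrite sqr_sqrtr// ltW.
have c1 : -1 <= x / r <= 1.
  rewrite -ler_norml normrM normfV (gtr0_norm r0) ler_pdivrMr// mul1r.
  by rewrite -(gtr0_norm r0) -ler_sqr ?nnegrE// !real_normK ?num_real// r2 lerDl sqr_ge0.
have s1 : sin (acos (x / r)) = `|y| / r.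
  rewrite sin_acos//.
  have -> : 1 - (x / r) ^+ 2 = (y / r) ^+ 2.
    have e2 : y ^+ 2 = r ^+ 2 - x ^+ 2 by rewrite r2; ring.
    by rewrite !exprMn !exprVn e2 mulrBl divff// gt_eqF// exprn_gt0.
  by rewrite sqrtr_sqr normrM normfV (gtr0_norm r0).
have rr : r != 0 by rewrite gt_eqF.
have [y0|y0] := leP 0 y.
  exists r, (acos (x / r)); split => //.
    by rewrite acosK// mulrC mulfVK.
  by rewrite s1 ger0_norm// mulrC mulfVK.
exists r, (- acos (x / r)); split => //.
  by rewrite cosN acosK// mulrC mulfVK.
by rewrite sinN s1 ltr0_norm// mulrN mulrC mulfVK// opprK.
Qed.

(** Define [psi] by integrating the angular velocity, starting from an angle of the
    vector at one point.  The components of the vector parallel and orthogonal to the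
    direction [psi] then satisfy the same scalar linear equation; the orthogonal one
    vanishes initially, hence always, and the parallel one stays positive. *)
Lemma polar_angle a X X' Y Y' : primitive a X X' -> primitive a Y Y' ->
  (forall x, a < x -> X x ^+ 2 + Y x ^+ 2 != 0) ->
  exists psi r, primitive a psi
      (fun t => (X t * Y' t - X' t * Y t) / (X t ^+ 2 + Y t ^+ 2)) /\
    forall x, a < x -> [/\ 0 < r x, X x = r x * cos (psi x) & Y x = r x * sin (psi x)].
Proof.
move=> pX pY n0; have cX := prim_cont pX; have cY := prim_cont pY.
pose i t := (X t ^+ 2 + Y t ^+ 2)^-1.
have ci : continuous_after a i by apply: contV => //; apply: contD; exact: contM.
pose g t := (X t * Y' t - X' t * Y t) / (X t ^+ 2 + Y t ^+ 2).
pose h t := (X t * X' t + Y t * Y' t) / (X t ^+ 2 + Y t ^+ 2).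
have lX' := prim_lint pX; have lY' := prim_lint pY.
have lg : loc_integrable a g.
  have -> : g = (fun t => i t * (X t * Y' t - Y t * X' t)).
    by apply/funext => t; rewrite /g mulrC [X' t * _]mulrC.
  by apply: lintM => //; apply: lintB; exact: lintM.
have lh : loc_integrable a h.
  have -> : h = (fun t => i t * (X t * X' t + Y t * Y' t)).
    by apply/funext => t; rewrite /h mulrC.
  by apply: lintM => //; apply: lintD; exact: lintM.
have ax0 : a < a + 1 by rewrite ltrDl.
have [r0 [th [r00 X0 Y0]]] := polar_pt (n0 _ ax0).
have [G pG G0] := lint_prim ax0 lg.
have [H pH H0] := lint_prim ax0 lh.
pose psi t := th + G t.
have ppsi : primitive a psi g.
  by apply: prim_ext (primD (prim_cst a th) pG) _ => t _; rewrite add0r.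
have ps := prim_sin ppsi; have pc := prim_cos ppsi.
pose A t := X t * sin (psi t) - Y t * cos (psi t).
pose B t := X t * cos (psi t) + Y t * sin (psi t).
have key t : a < t -> X' t = h t * X t - g t * Y t /\ Y' t = h t * Y t + g t * X t.
  by move=> /n0 nt; split; rewrite /h /g; field.
have pA : primitive a A (fun t => h t * A t).
  apply: prim_ext (primB (primM pX ps) (primM pY pc)) _ => t /key[e1 e2].
  by rewrite /A e1 e2; ring.
have pB : primitive a B (fun t => h t * B t).
  apply: prim_ext (primD (primM pX pc) (primM pY ps)) _ => t /key[e1 e2].
  by rewrite /B e1 e2; ring.
have psi0 : psi (a + 1) = th by rewrite /psi G0 addr0.
exists psi, B; split => // x ax.
have A0 : A x = 0.
  rewrite (prim_linear pH pA ax0 ax) {1}/A X0 Y0 psi0.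
  by rewrite -!mulrA [sin th * _]mulrC subrr mul0r.
have s2c2 := cos2Dsin2 (psi x).
split.
- rewrite (prim_linear pH pB ax0 ax) mulr_gt0// ?expR_gt0// /B X0 Y0 psi0.
  by rewrite -!mulrA -mulrDr -!expr2 cos2Dsin2 mulr1.
- have -> : X x = X x * (cos (psi x) ^+ 2 + sin (psi x) ^+ 2) by rewrite s2c2 mulr1.
  have -> : B x * cos (psi x) = X x * (cos (psi x) ^+ 2 + sin (psi x) ^+ 2) - A x * sin (psi x).
    by rewrite /A /B; ring.
  by rewrite A0 mul0r subr0.
- have -> : Y x = Y x * (cos (psi x) ^+ 2 + sin (psi x) ^+ 2) by rewrite s2c2 mulr1.
  have -> : B x * sin (psi x) = Y x * (cos (psi x) ^+ 2 + sin (psi x) ^+ 2) + A x * cos (psi x).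
    by rewrite /A /B; ring.
  by rewrite A0 mul0r addr0.
Qed.

Lemma cont_avoid_lt a f v x0 : continuous_after a f -> a < x0 -> f x0 < v ->
  (forall x, a < x -> f x != v) -> forall x, a < x -> f x < v.
Proof.
move=> cf ax0 fv nv x ax; rewrite ltNge; apply/negP => vx.
have hm (p q : R) : a < p -> p <= q -> Num.min (f p) (f q) <= v <= Num.max (f p) (f q) -> False.
  move=> ap pq hv; have [c] := IVT pq (cont_within cf ap) hv.
  rewrite in_itv/= => /andP[pc _] /eqP; apply/negP/nv; exact: lt_le_trans pc.
have [xx0|x0x] := leP x x0.
  by apply: (hm x x0) => //; rewrite ge_min le_max vx (ltW fv) orbT.
by apply: (hm x0 x) => //; [exact: ltW|rewrite ge_min le_max vx (ltW fv) orbT].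
Qed.

Lemma cos_odd_pi n : cos (pi + pi *+ 2 *+ n) = -1 :> R.
Proof.
elim: n => [|n ih]; first by rewrite mulr0n addr0 cospi.
by rewrite mulrSr addrA cosD2pi.
Qed.

(** The difference of the angles of two vectors that are never antiparallel avoids the
    odd multiples of [pi]; by the intermediate value theorem it stays between two of
    them. *)
Lemma angle_compare a f g : continuous_after a f -> continuous_after a g ->
  (forall x, a < x -> cos (f x - g x) != -1) ->
  exists M, forall x, a < x -> `|f x - g x| <= M.
Proof.
move=> cf cg nc.
pose D x := f x - g x.
have cD : continuous_after a D by exact: contB.
have ax0 : a < a + 1 by rewrite ltrDl.
pose n := (Num.truncn `|D (a + 1)|).+1.
pose v : R := pi + pi *+ 2 *+ n.
have pi1 : 1 <= pi *+ 2 :> R by have := pi_ge2 R; rewrite mulr2n; lra.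
have vx0 : `|D (a + 1)| < v.
  apply: lt_le_trans (truncnS_gt _) _.
  rewrite -/n /v; apply: (@le_trans _ _ (pi *+ 2 *+ n)).
    by rewrite -[X in _ <= X]mulr_natr -[leLHS]mul1r ler_wpM2r.
  by rewrite lerDr pi_ge0.
exists v => x ax; rewrite ler_norml; move: vx0; rewrite ltr_norml => /andP[h1 h2].
apply/andP; split; last first.
  apply/ltW/(cont_avoid_lt cD ax0 h2) => // y ay.
  by apply: contra (nc y ay) => /eqP; rewrite /D => ->; rewrite cos_odd_pi.
rewrite lerNl; apply/ltW.
apply: (cont_avoid_lt (contN cD) ax0 _ _ ax); first by rewrite ltrNl.
move=> y ay; apply: contra (nc y ay) => /eqP; rewrite /D => e.
by rewrite -cosN e cos_odd_pi.
Qed.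

End Derivatives.

(** * Existence for linear systems with locally integrable coefficients *)

Section Existence.
Context {R : realType}.
Implicit Types (a b x y z s t c d e : R) (f g h k F G H P V : R -> R).
Local Notation mu := (@lebesgue_measure R).

Lemma int_dct x y (Fn : nat -> R -> R) f g :
  (forall n, itv_integrable x y (Fn n)) -> (forall t, x <= t <= y -> Fn n t @[n --> \oo] --> f t) ->
  itv_integrable x y g -> (forall n t, x <= t <= y -> `|Fn n t| <= g t) ->
  itv_integrable x y f /\ intg x y (Fn n) @[n --> \oo] --> intg x y f.
Proof.
move=> Fi Ff gi Fg.
have mf : measurable_fun `[x, y] f.
  apply: (@measurable_fun_cvg _ _ _ _ Fn) => [n|t]; first exact: intbl_meas.
  by rewrite /= in_itv/=; exact: Ff.
have [] := @dominated_convergence _ _ _ mu `[x, y]%classic _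
  (fun n => EFin \o Fn n) (EFin \o f) (EFin \o g).
- exact: measurable_itv.
- by move=> n; exact: measurable_int (Fi n).
- exact/measurable_EFinP.
- apply: aeW => t /=; rewrite in_itv/= => xty.
  by apply: cvg_EFin; [exact: nearW|exact: Ff].
- exact: gi.
- apply: aeW => t n /=; rewrite in_itv/= => xty.
  by rewrite lee_fin Fg.
move=> fi _ cv; split => //.
apply: fine_cvg; rewrite fineK; first exact: cv.
exact: integrable_fin_num.
Qed.

(** The integral over an empty interval is zero, so the integral from [x0] is a primitive
    on both sides of [x0] when the density vanishes on the left. *)
Lemma prim_from a x0 g : a < x0 -> loc_integrable a g -> (forall t, t < x0 -> g t = 0) ->
  primitive a (fun x => intg x0 x g) g.
Proof.
move=> ax0 lg g0; have [G pG G0] := lint_prim ax0 lg.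
apply: (prim_extl pG) => x ax.
have [x0x|xx0] := leP x0 x.
  by case: pG => _ /(_ _ _ ax0 x0x); rewrite G0 subr0.
rewrite set_itv_ge ?Rintegral_set0 ?bnd_simp -?ltNge//.
have [_ /(_ x x0 ax (ltW xx0))] := pG.
rewrite G0 sub0r => /eqP; rewrite eqr_oppLR => /eqP ->.
rewrite (@int_ae_eq _ _ _ _ (fun=> 0)).
- by rewrite int_cst ?ltW// mul0r oppr0.
- exact: lg.
- exact: intbl_cst.
exists [set x0]; split => //; first exact: lebesgue_measure_set1.
move=> t /= ht; apply: contrapT => tx0; apply: ht => /andP[_ tle].
by apply: g0; rewrite lt_neqAle tle andbT; exact/eqP.
Qed.

Lemma prim_exprn a K k n : primitive a K k ->
  primitive a (fun t => K t ^+ n.+1) (fun t => n.+1%:R * K t ^+ n * k t).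
Proof.
move=> pK; elim: n => [|n ih].
  by apply: (prim_extl (f := K)); [apply: prim_ext pK _|] => t _; rewrite ?expr1// expr0; ring.
apply: (prim_extl (f := fun t => K t * K t ^+ n.+1)); last by move=> t _; rewrite -exprS.
by apply: prim_ext (primM pK ih) _ => t _; rewrite -[n.+2]addn1 natrD exprS; ring.
Qed.

Lemma cont_exprn a f n : continuous_after a f -> continuous_after a (fun t => f t ^+ n).
Proof.
move=> cf; elim: n => [|n ih]; first by move=> x _; exact: cvg_cst.
by under eq_fun do rewrite exprS; exact: contM.
Qed.

Section Picard.
Variables (a x0 : R) (P V : R -> R) (c1 c2 : R).
Hypotheses (ax0 : a < x0) (lP : loc_integrable a P) (lV : loc_integrable a V).
Hypotheses (P0 : forall t, t < x0 -> P t = 0) (V0 : forall t, t < x0 -> V t = 0).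

(** The terms of the Picard series, i.e. the differences of successive iterates. *)
Fixpoint picard_term n : (R -> R) * (R -> R) :=
  if n is m.+1 then
    ((fun x => intg x0 x (fun t => P t * (picard_term m).2 t)),
     (fun x => intg x0 x (fun t => V t * (picard_term m).1 t)))
  else ((fun=> c1), (fun=> c2)).

Let k t := `|P t| + `|V t|.
Let K x := intg x0 x k.
Let C := `|c1| + `|c2|.

Let lk : loc_integrable a k. Proof. by apply: lintD; exact: lint_norm. Qed.
Let pK : primitive a K k.
Proof. by apply: prim_from => // t tx; rewrite /k P0// V0// normr0 addr0. Qed.
Let k0 t : 0 <= k t. Proof. by rewrite addr_ge0. Qed.
Let K0 x : 0 <= K x. Proof. by apply: int_ge0 => t _; exact: k0. Qed.
Let C0 : 0 <= C. Proof. by rewrite addr_ge0. Qed.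
Let Kmono x y : a < x -> x <= y -> K x <= K y.
Proof.
move=> ax xy; rewrite -subr_ge0; have [_ ->//] := pK.
by apply: int_ge0 => t _; exact: k0.
Qed.

Let lMl f g : continuous_after a g -> loc_integrable a f -> loc_integrable a (fun t => f t * g t).
Proof. by move=> cg lf; under eq_fun do rewrite mulrC; exact: lintM. Qed.

Lemma picard_cont n : continuous_after a (picard_term n).1 /\ continuous_after a (picard_term n).2.
Proof.
elim: n => [|n [ih1 ih2]] /=; first by split => x _; exact: cvg_cst.
split.
- apply: (@prim_cont _ _ _ (fun t => P t * (picard_term n).2 t)).
  by apply: prim_from => //; [exact: lMl|move=> t /P0->; rewrite mul0r].
- apply: (@prim_cont _ _ _ (fun t => V t * (picard_term n).1 t)).
  by apply: prim_from => //; [exact: lMl|move=> t /V0->; rewrite mul0r].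
Qed.

(** The usual factorial estimate: the integral of [k * K ^+ n / n!] is
    [K ^+ n.+1 / n.+1!] because [K] is a primitive of [k]. *)
Lemma picard_bound n x : a < x ->
  `|(picard_term n).1 x| <= C * exp_coeff (K x) n /\
  `|(picard_term n).2 x| <= C * exp_coeff (K x) n.
Proof.
rewrite exp_coeffE /=.
elim: n x => [|n ih] x ax /=.
  by rewrite expr0 mulr1 fact0 invr1 mulr1 /C; split; rewrite (lerDl, lerDr).
have [ci1 ci2] := picard_cont n.
have step (W f : R -> R) : loc_integrable a W -> (forall t, `|W t| <= k t) -> continuous_after a f ->
    (forall t, a < t -> `|f t| <= C * (n`!%:R^-1 * K t ^+ n)) ->
    `|intg x0 x (fun t => W t * f t)| <= C * (n.+1`!%:R^-1 * K x ^+ n.+1).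
  move=> lW Wk cf fb.
  have [x0x|xx0] := leP x0 x; last first.
    rewrite set_itv_ge ?Rintegral_set0 ?bnd_simp -?ltNge// normr0.
    by rewrite !mulr_ge0// ?invr_ge0// exprn_ge0.
  have lKn : loc_integrable a (fun t => K t ^+ n * k t).
    by apply: lintM => //; apply: cont_exprn; exact: prim_cont pK.
  have -> : C * (n.+1`!%:R^-1 * K x ^+ n.+1) =
     intg x0 x (fun t => C / n`!%:R * (K t ^+ n * k t)).
    rewrite intZ; last exact: lKn.
    have := prim_exprn n pK; case=> _ /(_ x0 x ax0 x0x).
    have Kx0 : K x0 = 0 by exact: int_pt.
    rewrite Kx0 expr0n subr0 => e.
    have -> : K x ^+ n.+1 = n.+1%:R * intg x0 x (fun t => K t ^+ n * k t).
      rewrite -intZ; last exact: lKn.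
      by rewrite e; congr Rintegral; apply/funext => t; rewrite mulrA.
    have n1 : n.+1%:R != 0 :> R by rewrite pnatr_eq0.
    have n2 : n`!%:R != 0 :> R by rewrite pnatr_eq0 -lt0n fact_gt0.
    rewrite factS natrM; move: n1 n2.
    move: (n.+1%:R : R) (n`!%:R : R) => p q p0 q0.
    by field; rewrite ?p0 ?q0.
  apply: norm_int_le; first by apply: lMl.
    by apply: intblZ; exact: lKn.
  move=> t /andP[x0t _]; rewrite normrM.
  have at_ : a < t by exact: lt_le_trans x0t.
  apply: (@le_trans _ _ (k t * (C * (n`!%:R^-1 * K t ^+ n)))).
    by apply: ler_pM => //; exact: fb.
  by rewrite le_eqVlt; apply/orP; left; apply/eqP; ring.
split.
- by apply: step => // [t|t /ih[]//]; rewrite /k lerDl.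
- by apply: step => // [t|t /ih[]//]; rewrite /k lerDr.
Qed.

Let E x := limn (series (exp_coeff (K x))).

Let psum_le x y n : a < x -> x <= y -> series (fun n => C * exp_coeff (K x) n) n <= C * E y.
Proof.
move=> ax xy.
have -> : series (fun n => C * exp_coeff (K x) n) n = C * series (exp_coeff (K x)) n.
  by rewrite /series/= mulr_sumr.
apply: ler_wpM2l => //.
apply: (@le_trans _ _ (series (exp_coeff (K y)) n)).
  rewrite /series/=; apply: ler_sum => i _; rewrite !exp_coeffE /=.
  by rewrite ler_wpM2l ?invr_ge0// lerXn2r ?nnegrE// Kmono.
apply: nondecreasing_cvgn_le; last exact: is_cvg_series_exp_coeff.
by apply: nondecreasing_series => i _ _; exact: exp_coeff_ge0.
Qed.

Let sum_cvg (f : nat -> R -> R) :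
  (forall n x, a < x -> `|f n x| <= C * exp_coeff (K x) n) ->
  forall x, a < x -> cvgn (series (fun n => f n x)).
Proof.
move=> fb x ax; apply: normed_cvg.
apply: (@series_le_cvg _ _ (fun n => C * exp_coeff (K x) n)) => [n|n|n|].
- exact: normr_ge0.
- by rewrite mulr_ge0// exp_coeff_ge0.
- exact: fb.
- by apply: (@is_cvg_seriesZ _ (exp_coeff (K x)) C); exact: is_cvg_series_exp_coeff.
Qed.

Let sum_bound (f : nat -> R -> R) :
  (forall n x, a < x -> `|f n x| <= C * exp_coeff (K x) n) ->
  forall n x y, a < x -> x <= y -> `|series (fun n => f n x) n| <= C * E y.
Proof.
move=> fb n x y ax xy; apply: le_trans (psum_le n ax xy).
rewrite /series/=; apply: le_trans (ler_norm_sum _ _ _) _.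
by apply: ler_sum => i _; exact: fb.
Qed.

Let sum_int (W : R -> R) (c : R) (f g : nat -> R -> R) :
  loc_integrable a W -> (forall t, t < x0 -> W t = 0) ->
  (forall n, continuous_after a (f n)) ->
  (forall n x, a < x -> `|f n x| <= C * exp_coeff (K x) n) ->
  (forall n x, a < x -> `|g n x| <= C * exp_coeff (K x) n) ->
  (forall x, g 0%N x = c) -> (forall n x, g n.+1 x = intg x0 x (fun t => W t * f n t)) ->
  let u x := limn (series (fun n => g n x)) in
  let w x := limn (series (fun n => f n x)) in
  primitive a u (fun t => W t * w t) /\ u x0 = c.
Proof.
move=> lW W0 cf fb gb g0 gS u w.
have cS n : continuous_after a (fun x => series (fun n => f n x) n).
  elim: n => [|n ih].
    by under eq_fun do rewrite /series/= big_geq//; move=> x _; exact: cvg_cst.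
  by under eq_fun do rewrite seriesSr; exact: contD.
have gsum n x : a < x -> series (fun n => g n x) n.+1 =
    c + intg x0 x (fun t => W t * series (fun n => f n t) n).
  move=> ax; elim: n => [|n ih].
    rewrite seriesSr /series/= big_geq// add0r g0.
    have -> : (fun t => W t * \sum_(0 <= k < 0) f k t) = (fun=> 0).
      by apply/funext => t; rewrite big_geq// mulr0.
    by rewrite Rintegral_cst// mul0r addr0.
  rewrite seriesSr ih gS -addrA; congr (_ + _).
  rewrite -intD; [|by apply: lMl|by apply: lMl].
  by apply: eq_Rintegral => t _; rewrite seriesSr mulrDr.
have Wf x y : a < x -> itv_integrable x y (fun t => W t * w t) /\
   intg x y (fun t => W t * series (fun n => f n t) n) @[n --> \oo] -->
   intg x y (fun t => W t * w t).
  move=> ax; apply: (@int_dct _ _ _ _ (fun t => (C * E y) * `|W t|)).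
  - by move=> n; apply: lMl.
  - move=> t /andP[xt _]; have at_ : a < t by exact: lt_le_trans xt.
    by apply: cvgM; [exact: cvg_cst|exact: sum_cvg].
  - by apply: intblZ; apply: intbl_norm; exact: lW.
  - move=> n t /andP[xt ty]; have at_ : a < t by exact: lt_le_trans xt.
    by rewrite normrM mulrC ler_wpM2r// sum_bound.
have ue x : a < x -> u x = c + intg x0 x (fun t => W t * w t).
  move=> ax; apply/cvg_lim => //.
  rewrite -(cvg_shiftS (series (fun n => g n x))).
  under eq_fun do rewrite gsum//.
  by apply: cvgD; [exact: cvg_cst|exact: (Wf x0 x ax0).2].
have lWw : loc_integrable a (fun t => W t * w t) by move=> x y ax; exact: (Wf x y ax).1.
split; last by rewrite ue// int_pt addr0.
apply: (prim_extl (f := fun x => c + intg x0 x (fun t => W t * w t))); last first.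
  by move=> x ax; rewrite ue.
apply: (prim_ext (g := fun t => 0 + W t * w t)); last by move=> t _; rewrite add0r.
apply: primD; first exact: prim_cst.
by apply: prim_from => // t /W0->; rewrite mul0r.
Qed.

(** The Picard series converges locally uniformly, and dominated convergence lets the
    integral equation pass to its sum.  The coefficients vanish left of [x0], so the
    solution is constant there and only the forward problem is solved. *)
Lemma linear_system_solution : exists u w,
  [/\ primitive a u (fun t => P t * w t), primitive a w (fun t => V t * u t), u x0 = c1 & w x0 = c2].
Proof.
have b1 n x : a < x -> `|(picard_term n).1 x| <= C * exp_coeff (K x) n.
  by move=> /(picard_bound n)[].
have b2 n x : a < x -> `|(picard_term n).2 x| <= C * exp_coeff (K x) n.
  by move=> /(picard_bound n)[].
have [h1 h2] := @sum_int P c1 (fun n => (picard_term n).2) (fun n => (picard_term n).1)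
  lP P0 (fun n => (picard_cont n).2) b2 b1 (fun=> erefl) (fun _ _ => erefl).
have [h3 h4] := @sum_int V c2 (fun n => (picard_term n).1) (fun n => (picard_term n).2)
  lV V0 (fun n => (picard_cont n).1) b1 b2 (fun=> erefl) (fun _ _ => erefl).
by eexists; eexists; split; [exact: h1|exact: h3|exact: h2|exact: h4].
Qed.

End Picard.

Lemma prim_sub a b f g : a <= b -> primitive a f g -> primitive b f g.
Proof.
by move=> ab [lg fg]; split => [x y bx|x y bx xy];
  [apply: lg|apply: fg => //]; exact: le_lt_trans bx.
Qed.

(** At a regular endpoint the coefficients extended by zero are locally integrable across
    the endpoint, which may then serve as an initial point. *)
Lemma lint_extend a c g : loc_integrable a g -> a < c ->
  mu.-integrable `]a, c[%classic (fun x => (g x)%:E) ->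
  forall b, loc_integrable b (g \_ (halfline a)).
Proof.
move=> lg ac gi b x y bx.
pose m := (a + c) / 2.
have am : a < m by rewrite /m; lra.
have mc : m < c by rewrite /m; lra.
have i1 : mu.-integrable `]a, m]%classic (EFin \o g).
  by apply: integrableS gi => // t /=; rewrite !in_itv/= => /andP[-> tm]/=; exact: le_lt_trans mc.
have i2 : mu.-integrable `[m, y]%classic (EFin \o g) by exact: lg.
have mH : measurable (halfline a) by exact: measurable_itv.
have res (D : set R) : measurable (D : set (measurableTypeR R)) -> mu.-integrable D (EFin \o g) ->
    mu.-integrable setT (EFin \o (g \_ D)).
  by move=> mD gD; rewrite -restrict_EFin; apply: (integrable_mkcond _ _).1.
have j1 := res _ (measurable_itv _) i1.
have j2 := res _ (measurable_itv _) i2.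
have i3 : itv_integrable x y (fun t => `|(g \_ `]a, m]) t| + `|(g \_ `[m, y]) t|).
  apply: intblD; apply: intbl_norm.
    by apply: integrableS j1.
  by apply: integrableS j2.
apply: intbl_dom i3 _.
  apply/(@measurable_restrict _ _ _ _ _ `[x, y]%classic) => //.
  by apply: measurable_funS (lint_meas lg) => // t [].
move=> t /andP[xt ty]; rewrite !patchE.
case: ifPn => [|_]; last by rewrite normr0 addr_ge0.
rewrite inE /halfline /= in_itv/= andbT => at_.
have [tm|mt] := leP t m.
  by rewrite (mem_set (_ : `]a, m]%classic t)) ?lerDl//= in_itv/= at_ tm.
by rewrite (mem_set (_ : `[m, y]%classic t)) ?lerDr//= in_itv/= ty ltW.
Qed.

End Existence.

(** * Sturm-Liouville solutions and comparison of their angles *)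

Section Solutions.
Context {R : realType}.
Implicit Types (a b x y z s t c d E : R) (f g p q r u pu v pv P V theta : R -> R).
Local Notation mu := (@lebesgue_measure R).

Definition sl_system a P V u pu :=
  primitive a u (fun t => P t * pu t) /\ primitive a pu (fun t => V t * u t).

Lemma coef_lint a p q r E : sl_coefficients a p q r ->
  loc_integrable a (fun t => (p t)^-1) /\ loc_integrable a (fun t => q t - E * r t).
Proof.
move=> [lp lq lr _ _]; split; first exact: lint_of_loc.
by apply: lintB; [exact: lint_of_loc|apply: lintZ; exact: lint_of_loc].
Qed.

Lemma abs_cont_loc_cont a f : abs_cont_loc a f -> continuous_after a f.
Proof.
move=> [g lg fg]; apply: (@prim_cont _ _ _ g); split => //; exact: lint_of_loc.
Qed.

(** The integral form of the equation; from here on a solution is handled as a solution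
    of a first order system. *)
Lemma solution_system a p q r E u pu : sl_coefficients a p q r ->
  solution a p q r E u pu <->
  sl_system a (fun t => (p t)^-1) (fun t => q t - E * r t) u pu.
Proof.
move=> co; have [lp lq] := coef_lint E co; split.
  move=> [au ap du dp]; have cu := abs_cont_loc_cont au; have cp := abs_cont_loc_cont ap.
  split.
    apply: (prim_ext (g := fun t => pu t / p t)); last by move=> t _; rewrite mulrC.
    by apply: prim_of_abs_cont => //; apply: lint_meas; exact: lintM.
  apply: prim_of_abs_cont => //; apply: lint_meas.
  by under eq_fun do rewrite mulrC; exact: lintM.
move=> [pu' pp]; split.
- exact: prim_abs_cont pu'.
- exact: prim_abs_cont pp.
- apply: prim_ae_derivative; apply: prim_ext pu' _ => t _; exact: mulrC.
- exact: prim_ae_derivative pp.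
Qed.

Lemma system_cont a P V u pu : sl_system a P V u pu -> continuous_after a u /\ continuous_after a pu.
Proof. by move=> [/prim_cont ? /prim_cont ?]. Qed.

(** The Wronskian of solutions of two different equations changes only through the
    difference of the coefficients. *)
Lemma prim_wronskian a P0 V0 u pu P1 V1 v pv :
  sl_system a P0 V0 u pu -> sl_system a P1 V1 v pv ->
  primitive a (wronskian u pu v pv)
    (fun t => (V1 t - V0 t) * (u t * v t) + (P0 t - P1 t) * (pu t * pv t)).
Proof.
move=> [h1 h2] [h3 h4].
by apply: prim_ext (primB (primM h1 h4) (primM h2 h3)) _ => t _; ring.
Qed.

Lemma wronskian_const a P V u pu v pv x y :
  sl_system a P V u pu -> sl_system a P V v pv -> a < x -> a < y ->
  wronskian u pu v pv x = wronskian u pu v pv y.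
Proof.
move=> h1 h2; apply: prim0_const.
by apply: prim_ext (prim_wronskian h1 h2) _ => t _; ring.
Qed.

Lemma restrict_halfline a g t : a < t -> (g \_ (halfline a)) t = g t.
Proof. by move=> at_; rewrite patchE mem_set// /halfline /= in_itv/= at_. Qed.

Lemma restrict_below a g t : t < a -> (g \_ (halfline a)) t = 0.
Proof.
move=> ta; rewrite patchE memNset// /halfline /= in_itv/= andbT.
by apply/negP; rewrite -leNgt ltW.
Qed.

Lemma coef_extend a p q r E : sl_coefficients a p q r -> regular_at_left a p q r ->
  forall b, loc_integrable b ((fun t => (p t)^-1) \_ (halfline a)) /\
    loc_integrable b ((fun t => q t - E * r t) \_ (halfline a)).
Proof.
move=> co [c ac [ip iq ir]] b; have [lp lq] := coef_lint E co.
split; first exact: lint_extend ip _.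
apply: lint_extend lq ac _ _.
have -> : (fun x => (q x - E * r x)%:E) = (fun x => (q x)%:E - E%:E * (r x)%:E)%E by [].
by apply: integrableB => //; exact: integrableZl.
Qed.

Lemma prufer_nonvanishing a u pu theta : prufer_angle a u pu theta ->
  forall x, a < x -> pu x ^+ 2 + u x ^+ 2 != 0.
Proof.
move=> [_ [rad hr]] x /hr[r0 -> ->].
by rewrite !exprMn -mulrDr cos2Dsin2 mulr1 expf_neq0// gt_eqF.
Qed.

(** Solve the initial value problem at the regular endpoint.  A second solution with
    Wronskian 1 shows that the vector [(pu, u)] never vanishes, so that it has a
    continuous angle. *)
Lemma exists_prufer a p q r E : sl_coefficients a p q r -> regular_at_left a p q r ->
  exists u pu theta, nontrivial_solution a p q r E u pu /\ prufer_angle a u pu theta.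
Proof.
move=> co re; pose b := a - 1; have ba : b < a by rewrite /b; lra.
have [lP lV] := coef_extend E co re b.
set P := _ \_ _ in lP; set V := _ \_ _ in lV.
have P0 t : t < a -> P t = 0 by exact: restrict_below.
have V0 t : t < a -> V t = 0 by exact: restrict_below.
have [u [pu [su spu ua pua]]] := linear_system_solution 1 0 ba lP lV P0 V0.
have [v [pv [sv spv va pva]]] := linear_system_solution 0 1 ba lP lV P0 V0.
have W1 x : b < x -> wronskian u pu v pv x = 1.
  move=> bx; rewrite (@wronskian_const b P V u pu v pv x a)// /wronskian ua pua va pva.
  by ring.
have nz x : a < x -> pu x ^+ 2 + u x ^+ 2 != 0.
  move=> ax; apply/negP; rewrite paddr_eq0 ?sqr_ge0// !expf_eq0/= => /andP[/eqP p0 /eqP u0].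
  have := W1 x (lt_trans ba ax); rewrite /wronskian p0 u0 !mul0r subrr => /eqP.
  by rewrite eq_sym oner_eq0.
have psu := prim_sub (ltW ba) su; have pspu := prim_sub (ltW ba) spu.
have [psi [rad [ppsi hr]]] := polar_angle pspu psu nz.
exists u, pu, psi; split; last first.
  split; first exact: prim_cont ppsi.
  by exists rad => x /hr[r0 e1 e2].
split.
  apply/solution_system => //; split.
    by apply: prim_ext psu _ => t at_; rewrite /P restrict_halfline.
  by apply: prim_ext pspu _ => t at_; rewrite /V restrict_halfline.
have h2 : 0 < 1 / 2 :> R by rewrite divr_gt0.
(* [u] is 1 at the endpoint, hence nonzero just to the right of it *)
have [d d0 hd] := cont_osc (prim_cont su) ba h2.
exists (a + d / 2); first by rewrite ltrDl divr_gt0.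
apply/negP => /eqP ud.
have := hd a (a + d / 2); rewrite ua ud subr0 normr1 => h.
have : 1 <= 1 / 2 :> R by apply: h; apply/andP; split; lra.
lra.
Qed.

(** The angular velocity of [(pu, u)] is at most [|1/p| + |q - E r|], which is integrable up
    to the regular endpoint. *)
Lemma prufer_bounded_left a p q r E u pu theta : sl_coefficients a p q r ->
  regular_at_left a p q r -> solution a p q r E u pu -> prufer_angle a u pu theta ->
  forall X, exists M, forall x, a < x -> x <= X -> `|theta x| <= M.
Proof.
move=> co re /(solution_system _ _ _ co)[su spu] pth X.
have nz := prufer_nonvanishing pth.
have [psi [rad [ppsi hr]]] := polar_angle spu su nz.
have [cth [rad' hr']] := pth.
have cpsi := prim_cont ppsi.
have [M1 hM1] : exists M, forall x, a < x -> `|theta x - psi x| <= M.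
  apply: angle_compare => // x ax.
  have [r0 e1 e2] := hr x ax; have [r0' e1' e2'] := hr' x ax.
  apply/negP => /eqP; rewrite cosB => cc.
  have : rad x * rad' x * (cos (theta x) * cos (psi x) + sin (theta x) * sin (psi x)) =
    pu x ^+ 2 + u x ^+ 2.
    transitivity ((rad' x * cos (theta x)) * (rad x * cos (psi x)) +
      (rad' x * sin (theta x)) * (rad x * sin (psi x))); first by ring.
    by rewrite -e1 -e2 -e1' -e2' !expr2.
  rewrite cc => e; have : 0 <= pu x ^+ 2 + u x ^+ 2 by rewrite addr_ge0// sqr_ge0.
  by rewrite -e mulrN1 oppr_ge0 leNgt mulr_gt0.
pose b := a - 1; have ba : b < a by rewrite /b; lra.
have [lP lV] := coef_extend E co re b.
set P := _ \_ _ in lP; set V := _ \_ _ in lV.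
pose k t := `|P t| + `|V t|.
have lk : loc_integrable b k by apply: lintD; exact: lint_norm.
have k0 t : 0 <= k t by rewrite addr_ge0.
pose Y := Num.max X (a + 1).
have aY : a < Y by rewrite /Y lt_max ltrDl ltr01 orbT.
exists (M1 + (`|psi Y| + intg a Y k)) => x ax xX.
have xY : x <= Y by rewrite le_max xX.
have -> : theta x = (theta x - psi x) + psi x by rewrite subrK.
apply: le_trans (ler_normD _ _) _; apply: lerD; first exact: hM1.
have -> : psi x = psi Y - (psi Y - psi x) by ring.
apply: le_trans (ler_normB _ _) _; apply: lerD => //.
have [lg ->//] := ppsi.
apply: (@le_trans _ _ (intg x Y k)); last first.
  by apply: int_mono => //; [exact: ltW|exact: lk].
apply: norm_int_le; [exact: lg|by apply: lk; exact: lt_trans ax|].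
move=> t /andP[xt _]; have at_ : a < t by exact: lt_le_trans xt.
have nt := nz t at_.
have nt0 : 0 < pu t ^+ 2 + u t ^+ 2 by rewrite lt_neqAle eq_sym nt addr_ge0// sqr_ge0.
rewrite normrM normfV (gtr0_norm nt0) ler_pdivrMr//.
rewrite /k /P /V !restrict_halfline//.
have -> : pu t * ((p t)^-1 * pu t) - (q t - E * r t) * u t * u t =
  (p t)^-1 * pu t ^+ 2 - (q t - E * r t) * u t ^+ 2 by ring.
apply: le_trans (ler_normB _ _) _.
have nsq (x1 y1 : R) : `|x1 * y1 ^+ 2| = `|x1| * y1 ^+ 2.
  by rewrite normrM (ger0_norm (sqr_ge0 _)).
rewrite !nsq mulrDl !mulrDr.
have h1 : 0 <= `|(p t)^-1| * u t ^+ 2 by rewrite mulr_ge0// sqr_ge0.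
have h2 : 0 <= `|q t - E * r t| * pu t ^+ 2 by rewrite mulr_ge0// sqr_ge0.
lra.
Qed.

Lemma cos_eqN1_antipodal (f g : R) : cos (f - g) = -1 -> cos f = - cos g /\ sin f = - sin g.
Proof.
move=> c1; have s0 : sin (f - g) = 0 by apply: cos1sin0; rewrite c1 normrN1.
have -> : f = g + (f - g) by ring.
by rewrite cosD c1 s0 sinD c1 s0 !mulr0 subr0 addr0 !mulrN1.
Qed.

(** In the coefficient plane of the basis (u0, v0) the solution [w0] is the fixed vector
    [(c, d)] and [w1] is the moving vector [(A, B)].  As the basis has Wronskian 1, the
    wedge product of the two solutions is that of the coefficient vectors, and where it
    vanishes the two solutions are parallel with the same factor as the coefficients.
    So the angle between the coefficient vectors and the angle between the solutions
    belong to vectors that are never antiparallel.  Likewise [(A, B)] is never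
    antiparallel to its image [(A + beta B, |beta| B)], because this linear map has the
    positive eigenvalues 1 and |beta|; the sign [s] is that of [beta], since [psi] is the
    angle of [(A + beta B, beta B)]. *)
Lemma relative_angle a (u0 pu0 v0 pv0 A B A' B' beta w0 pw0 w1 pw1 th0 th1 psi rpsi : R -> R) c d :
  (forall x, a < x -> wronskian u0 pu0 v0 pv0 x = 1) ->
  primitive a A A' -> primitive a B B' ->
  (forall x, a < x -> 0 < beta x) \/ (forall x, a < x -> beta x < 0) ->
  (forall x, a < x -> w0 x = c * u0 x + d * v0 x /\ pw0 x = c * pu0 x + d * pv0 x) ->
  (forall x, a < x -> w1 x = A x * u0 x + B x * v0 x /\ pw1 x = A x * pu0 x + B x * pv0 x) ->
  prufer_angle a w0 pw0 th0 -> prufer_angle a w1 pw1 th1 ->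
  continuous_after a psi ->
  (forall x, a < x -> [/\ 0 < rpsi x, A x + beta x * B x = rpsi x * cos (psi x) &
     beta x * B x = rpsi x * sin (psi x)]) ->
  exists M s, (s = 1 \/ s = -1) /\ forall x, a < x -> `|(th1 x - th0 x) + s * psi x| <= M.
Proof.
move=> W1 pA pB sb w0E w1E [cth0 [rad0 h0]] [cth1 [rad1 h1]] cpsi hpsi.
have nzcd : c ^+ 2 + d ^+ 2 != 0.
  apply/negP; rewrite paddr_eq0 ?sqr_ge0// !expf_eq0/= => /andP[/eqP c0 /eqP d0].
  have ax : a < a + 1 by rewrite ltrDl.
  have := prufer_nonvanishing (conj cth0 (ex_intro _ rad0 h0)) ax.
  by have [-> ->] := w0E _ ax; rewrite c0 d0 !mul0r addr0 expr0n addr0 eqxx.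
have [R0 [gam [R00 cE dE]]] := polar_pt nzcd.
have nzAB x : a < x -> A x ^+ 2 + B x ^+ 2 != 0.
  move=> ax; apply/negP; rewrite paddr_eq0 ?sqr_ge0// !expf_eq0/= => /andP[/eqP c0 /eqP d0].
  have := prufer_nonvanishing (conj cth1 (ex_intro _ rad1 h1)) ax.
  by have [-> ->] := w1E _ ax; rewrite c0 d0 !mul0r addr0 expr0n addr0 eqxx.
have [phi [RR [pphi hphi]]] := polar_angle pA pB nzAB.
have cphi := prim_cont pphi.
(* the angle of (A, B) relative to (c, d) against that of w1 relative to w0 *)
have [M1 hM1] : exists M, forall x, a < x -> `|phi x - (gam - (th1 x - th0 x))| <= M.
  apply: angle_compare => //.
    by apply: contB; [move=> x _; exact: cvg_cst|exact: contB].
  move=> x ax; apply/negP => /eqP /cos_eqN1_antipodal.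
  rewrite (cosB gam) (sinB gam) => -[e1 e2].
  have [RR0 AE BE] := hphi x ax.
  have [r00 w0s w0c] := h0 x ax; have [r10 w1s w1c] := h1 x ax.
  have [w0x pw0x] := w0E x ax; have [w1x pw1x] := w1E x ax.
  pose k := R0 * RR x; pose l := rad0 x * rad1 x.
  have k0 : 0 < k by rewrite mulr_gt0.
  have l0 : 0 < l by rewrite mulr_gt0.
  have g2 := cos2Dsin2 gam.
  have wedge : k * (sin (phi x) * cos gam - cos (phi x) * sin gam) = - l * sin (th1 x - th0 x).
    transitivity (c * B x - d * A x); first by rewrite AE BE {1}cE {1}dE /k; ring.
    transitivity ((c * B x - d * A x) * wronskian u0 pu0 v0 pv0 x); first by rewrite W1// mulr1.
    transitivity (w0 x * pw1 x - pw0 x * w1 x).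
      by rewrite w0x pw0x w1x pw1x /wronskian; ring.
    by rewrite w0s w0c w1s w1c sinB /l; ring.
  have sD : sin (phi x) * cos gam - cos (phi x) * sin gam = sin (th1 x - th0 x).
    by rewrite e1 e2; move: g2; set C := cos gam; set S := sin gam;
      set s := sin (_ - _); set q := cos (_ - _) => g2;
      transitivity (s * (C ^+ 2 + S ^+ 2)); [ring|rewrite g2 mulr1].
  have s0 : sin (th1 x - th0 x) = 0.
    have /eqP : (k + l) * sin (th1 x - th0 x) = 0.
      by rewrite mulrDl -{1}sD wedge; ring.
    by rewrite mulf_eq0 gt_eqF ?addr_gt0//= => /eqP.
  have cD : cos (phi x) * cos gam + sin (phi x) * sin gam = - cos (th1 x - th0 x).
    by rewrite e1 e2; move: g2; set C := cos gam; set S := sin gam;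
      set s := sin (_ - _); set q := cos (_ - _) => g2;
      transitivity (- q * (C ^+ 2 + S ^+ 2)); [ring|rewrite g2 mulr1].
  have para : c * B x = d * A x.
    by apply/eqP; rewrite -subr_eq0 AE BE {1}cE {1}dE; apply/eqP;
      transitivity (k * (sin (phi x) * cos gam - cos (phi x) * sin gam));
      [rewrite /k; ring|rewrite sD s0 mulr0].
  have dot1 : w0 x * w1 x + pw0 x * pw1 x = l * cos (th1 x - th0 x).
    by rewrite w0s w0c w1s w1c cosB /l; ring.
  have dot2 : c * A x + d * B x = - k * cos (th1 x - th0 x).
    transitivity (k * (cos (phi x) * cos gam + sin (phi x) * sin gam)).
      by rewrite AE BE {1}cE {1}dE /k; ring.
    by rewrite cD; ring.
  have key : (c ^+ 2 + d ^+ 2) * (w0 x * w1 x + pw0 x * pw1 x) =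
    (c * A x + d * B x) * (w0 x ^+ 2 + pw0 x ^+ 2).
    rewrite w0x pw0x w1x pw1x.
    transitivity ((c * A x + d * B x) * ((c * u0 x + d * v0 x) ^+ 2 + (c * pu0 x + d * pv0 x) ^+ 2)
      + (c * B x - d * A x) * ((c * u0 x + d * v0 x) * (c * v0 x - d * u0 x) +
         (c * pu0 x + d * pv0 x) * (c * pv0 x - d * pu0 x))); first by ring.
    by rewrite para subrr mul0r addr0.
  have c0 : cos (th1 x - th0 x) = 0.
    have N0 : 0 < w0 x ^+ 2 + pw0 x ^+ 2.
      rewrite lt_neqAle eq_sym addr_ge0 ?sqr_ge0// andbT addrC.
      exact: (prufer_nonvanishing (conj cth0 (ex_intro _ rad0 h0)) ax).
    have M0 : 0 < c ^+ 2 + d ^+ 2 by rewrite lt_neqAle eq_sym nzcd addr_ge0// sqr_ge0.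
    have /eqP : ((c ^+ 2 + d ^+ 2) * l + k * (w0 x ^+ 2 + pw0 x ^+ 2)) * cos (th1 x - th0 x) = 0.
      by rewrite mulrDl -mulrA -dot1 key dot2; ring.
    by rewrite mulf_eq0 gt_eqF ?addr_gt0 ?mulr_gt0//= => /eqP.
  have := cos2Dsin2 (th1 x - th0 x); rewrite c0 s0 expr0n addr0 => /eqP.
  by rewrite eq_sym oner_eq0.
(* (A, B) against (A + beta B, |beta| B), whose angle is [s * psi] *)
have [M2 [s [hs hM2]]] : exists M s, (s = 1 \/ s = -1) /\
    forall x, a < x -> `|s * psi x - phi x| <= M.
  have [s [hs sbeta]] : exists s : R, (s = 1 \/ s = -1) /\ forall x, a < x -> 0 < s * beta x.
    case: sb => sb; [exists 1|exists (-1)]; split; [by left| |by right|] => x /sb.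
      by rewrite mul1r.
    by rewrite mulN1r oppr_gt0.
  have cosS y : cos (s * y) = cos y by case: hs => ->; rewrite ?mul1r ?mulN1r ?cosN.
  have sinS y : sin (s * y) = s * sin y.
    by case: hs => ->; rewrite ?mul1r ?mulN1r ?sinN ?mulN1r.
  have ss : s * s = 1 by case: hs => ->; rewrite ?mulr1// mulrNN mulr1.
  have [M hM] : exists M, forall x, a < x -> `|s * psi x - phi x| <= M.
    apply: angle_compare => //.
      by apply: contM => // x _; exact: cvg_cst.
    move=> x ax; apply/negP => /eqP /cos_eqN1_antipodal; rewrite cosS sinS => -[e1 e2].
    have [RR0 AE BE] := hphi x ax.
    have [r0 yE zE] := hpsi x ax.
    have B0 : B x = 0.
      have /eqP : (RR x * (s * beta x) + rpsi x) * B x = 0.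
        have -> : (RR x * (s * beta x) + rpsi x) * B x =
           RR x * s * (beta x * B x) + rpsi x * B x by ring.
        rewrite zE {1}BE; have -> : sin (phi x) = - (s * sin (psi x)) by rewrite e2 opprK.
        by ring.
      have pos : 0 < RR x * (s * beta x) + rpsi x.
        by apply: addr_gt0 => //; apply: mulr_gt0 => //; exact: sbeta.
      by rewrite mulf_eq0 (gt_eqF pos)/= => /eqP.
    have A0 : A x = 0.
      have /eqP : (RR x + rpsi x) * A x = 0.
        rewrite mulrDl; move: yE; rewrite B0 mulr0 addr0 => yE.
        rewrite {1}yE {1}AE e1; ring.
      by rewrite mulf_eq0 gt_eqF ?addr_gt0//= => /eqP.
    by have := nzAB x ax; rewrite A0 B0 expr0n addr0 eqxx.
  by exists M, s.
exists (M2 + M1 + `|gam|), s; split => // x ax.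
have -> : th1 x - th0 x + s * psi x =
  (s * psi x - phi x) + (phi x - (gam - (th1 x - th0 x))) + gam by ring.
apply: le_trans (ler_normD _ _) _; apply: lerD => //.
by apply: le_trans (ler_normD _ _) _; apply: lerD; [exact: hM2|exact: hM1].
Qed.

End Solutions.

(** * Averaging over windows where rho is nearly constant *)

Section Averaging.
Context {R : realType}.
Implicit Types (a b x y z s t c d e l m : R) (f g rho F psi : R -> R).
Local Notation mu := (@lebesgue_measure R).

Lemma aeI (P Q : R -> Prop) : {ae mu, forall x, P x} -> {ae mu, forall x, Q x} ->
  {ae mu, forall x, P x /\ Q x}.
Proof. by move=> hP hQ; apply: filterS2 hP hQ => x; split. Qed.

Lemma ae_exists_between (P : R -> Prop) s t : {ae mu, forall x, P x} -> s < t ->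
  exists2 x, s < x < t & P x.
Proof.
move=> [N [mN N0 PN]] st; apply: contrapT => h.
have sub : `]s, t[ `<=` N.
  move=> x /=; rewrite in_itv/= => sxt; apply: PN => /= Px.
  by apply: h; exists x.
have : (mu `]s, t[%classic <= mu N)%E by apply: le_measure; rewrite ?inE.
rewrite N0 lebesgue_measure_itv/= lte_fin st -EFinB lee_fin subr_le0.
by rewrite leNgt st.
Qed.

Section Translation.
Variable v : R.
Definition translate (t : measurableTypeR R) : measurableTypeR R := v + t.

Lemma measurable_translate : measurable_fun setT translate.
Proof. by apply: measurable_funD. Qed.

HB.instance Definition _ := isMeasurableFun.Build _ _ _ _ translate measurable_translate.

Lemma lebesgue_measure_translate (A : set R) : measurable A ->
  pushforward mu translate A = mu A.
Proof.
move=> mA; apply/esym/lebesgue_measure_unique => //= _ [[p q]] _ <-.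
rewrite /pushforward/=.
have -> : translate @^-1` `]p, q] = `]p - v, q - v]%classic.
  apply/seteqP; split => t; rewrite /translate /= !in_itv/= => /andP[h1 h2];
    apply/andP; split; lra.
rewrite !lebesgue_measure_itv/= !lte_fin.
have -> : (p - v < q - v) = (p < q) by rewrite ltrD2r.
by case: ifP => // _; congr EFin; ring.
Qed.

(** Lebesgue measure is translation invariant. *)
Lemma int_translate l f : measurable_fun `[v, v + l] f ->
  (forall t, v <= t <= v + l -> 0 <= f t) ->
  intg 0 l (fun t => f (v + t)) = intg v (v + l) f.
Proof.
move=> mf f0; rewrite /Rintegral; congr fine.
have -> : `[0, l]%classic = translate @^-1` `[v, v + l].
  apply/seteqP; split => t; rewrite /translate /= !in_itv/= => /andP[h1 h2];
    apply/andP; split; lra.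
pose D : set R := `[v, v + l]%classic.
transitivity (\int[pushforward mu translate]_(y in D) (f y)%:E)%E.
  rewrite ge0_integral_pushforward//=.
  - exact: measurable_itv.
  - exact/measurable_EFinP.
  - by move=> t; rewrite inE /D/= in_itv/= lee_fin; exact: f0.
by apply: eq_measure_integral => A mA _; exact: lebesgue_measure_translate.
Qed.

End Translation.

Lemma intbl_ae_bound x y f c : 0 <= c -> measurable_fun `[x, y] f ->
  {ae mu, forall t, x <= t <= y -> `|f t| <= c} -> itv_integrable x y f.
Proof.
move=> c0 mf fc; apply: (@intbl_ae _ _ _ f (fun t => Num.max (- c) (Num.min (f t) c))) => //.
  apply: (@intbl_bound _ _ _ _ c).
    by apply: measurable_maxr => //; apply: measurable_minr.
  move=> t _; rewrite ler_norml le_max lexx/= ge_max ge_min lexx orbT andbT.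
  lra.
apply: filterS fc => t h /h; rewrite ler_norml => /andP[h1 h2].
by rewrite min_l// max_r.
Qed.

(** The hypotheses on [rho] concern almost every point, but they are needed at all large
    points.  They hold at some [x'] in (x - 1, x); the window of length
    [l + 1] at [x'] contains the window of length [l] at [x], and [m] is the value of [rho]
    at [x']. *)
Lemma slowly_varying a rho : loc_integrable a rho ->
  {ae mu, forall x, a < x -> 0 < rho x} ->
  rho x @[x --> ae_pinfty] --> (0 : R) ->
  (forall l : R, 0 < l ->
     (fun x => l^-1 * \int[mu]_(t in `[0, l]) `|rho (x + t) - rho x|) =o_ae_pinfty rho) ->
  forall l e, 0 < l -> 0 < e -> exists2 X, a < X & forall x, X <= x ->
    exists m, [/\ 0 < m, m <= e & intg x (x + l) (fun t => `|rho t - m|) <= e * m].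
Proof.
move=> lrho rho0 rhocvg rhoo l e l0 e0.
have l1 : 0 < l + 1 by lra.
have /eqoP/(_ (e / (l + 1))) := rhoo _ l1.
rewrite divr_gt0// => /(_ isT) [M1 hM1].
have /cvgrPdist_le/(_ e e0) [M2 hM2] := rhocvg.
pose M := Num.max a (Num.max M1 M2).
have Ma : a <= M by rewrite le_max lexx.
have MM1 : M1 <= M by rewrite !le_max lexx orbT.
have MM2 : M2 <= M by rewrite !le_max lexx !orbT.
exists (M + 1) => [|x Mx]; first lra.
have xx : x - 1 < x by lra.
have good := aeI rho0 (aeI hM1 hM2).
have [x' /andP[x'1 x'2] [h0 [h1 h2]]] := ae_exists_between good xx.
have ax' : a < x' by lra.
have r0 := h0 ax'.
have {}h1 := h1 ltac:(lra); have {}h2 := h2 ltac:(lra).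
exists (rho x'); split => //.
  by move: h2; rewrite sub0r normrN; apply: le_trans; exact: ler_norm.
have lf : loc_integrable a (fun t => `|rho t - rho x'|).
  by apply: lint_norm; apply: lintB => //; apply: lint_cont => y _; exact: cvg_cst.
apply: (@le_trans _ _ (intg x' (x' + (l + 1)) (fun t => `|rho t - rho x'|))).
  by apply: int_mono; rewrite ?lexx//; try lra; exact: lf.
rewrite -int_translate//; last by apply: intbl_meas; exact: lf.
move: h1 => /=; rewrite (gtr0_norm r0) ger0_norm; last first.
  by rewrite mulr_ge0// ?invr_ge0 ?(ltW l1)//; apply: int_ge0.
by rewrite mulrAC -ler_pdivlMl ?invr_gt0// invrK mulrC mulfVK// gt_eqF.
Qed.

(** The velocity of the angle [psi] in the time log |beta| when the integrand has the
    constant value [f]. *)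
Definition slow_field (th f : R) := sin th * cos th - sin th ^+ 2 + f * cos th ^+ 2.

Lemma lipschitz_trig (phi dphi : R -> R) x y :
  (forall t : R, is_derive t 1 phi (dphi t)) -> (forall t, `|dphi t| <= 1) ->
  `|phi x - phi y| <= `|x - y|.
Proof.
move=> dp d1.
have cp p q : {within `[p, q], continuous phi}.
  by apply: derivable_within_continuous => w _; have [] := dp w.
wlog yx : x y / y <= x.
  move=> h; have [/h//|/ltW /h] := leP y x.
  by rewrite distrC [X in _ <= X]distrC.
have [c _ ->] := MVT_segment yx (fun t _ => dp t) (@cp _ _).
by rewrite normrM ler_piMl.
Qed.

Lemma sin_lipschitz x y : `|sin x - sin y| <= `|x - y|.
Proof. by apply: (@lipschitz_trig sin cos) => t; exact: cos_max. Qed.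

Lemma cos_lipschitz x y : `|cos x - cos y| <= `|x - y|.
Proof.
by apply: (@lipschitz_trig cos (fun t => - sin t)) => t; rewrite normrN; exact: sin_max.
Qed.

Lemma prod_lipschitz (f g : R -> R) x y : (forall t, `|f t| <= 1) -> (forall t, `|g t| <= 1) ->
  (forall x y, `|f x - f y| <= `|x - y|) -> (forall x y, `|g x - g y| <= `|x - y|) ->
  `|f x * g x - f y * g y| <= 2 * `|x - y|.
Proof.
move=> f1 g1 fl gl.
have -> : f x * g x - f y * g y = (f x - f y) * g x + f y * (g x - g y) by ring.
apply: le_trans (ler_normD _ _) _; rewrite !normrM mulr_natl mulr2n.
by apply: lerD; [rewrite -[leRHS]mulr1|rewrite -[leRHS]mul1r]; apply: ler_pM.
Qed.

Lemma slow_field_bound (th f : R) : `|slow_field th f| <= 2 + `|f|.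
Proof.
have s1 := sin_max th; have c1 := cos_max th.
have sq z : `|z| <= 1 -> `|z ^+ 2| <= 1 by move=> z1; rewrite normrX exprn_ile1.
apply: le_trans (ler_normD _ _) _; apply: lerD.
  apply: le_trans (ler_normB _ _) _.
  have h1 : `|sin th * cos th| <= 1 by rewrite normrM mulr_ile1.
  by have h2 := sq _ s1; lra.
by rewrite normrM ler_piMr// sq.
Qed.

Lemma slow_field_lipschitz (x y f : R) :
  `|slow_field x f - slow_field y f| <= (4 + 2 * `|f|) * `|x - y|.
Proof.
have sl := sin_lipschitz; have cl := cos_lipschitz.
have s1 := @sin_max R; have c1 := @cos_max R.
have -> : slow_field x f - slow_field y f =
  (sin x * cos x - sin y * cos y) - (sin x * sin x - sin y * sin y) +
  f * (cos x * cos x - cos y * cos y) by rewrite /slow_field; ring.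
have h1 := prod_lipschitz x y s1 c1 sl cl.
have h2 := prod_lipschitz x y s1 s1 sl sl.
have h3 := prod_lipschitz x y c1 c1 cl cl.
apply: le_trans (ler_normD _ _) _.
have h4 := ler_normB (sin x * cos x - sin y * cos y) (sin x * sin x - sin y * sin y).
have h5 : `|f * (cos x * cos x - cos y * cos y)| <= `|f| * (2 * `|x - y|).
  by rewrite normrM ler_wpM2l.
rewrite mulrDl; have -> : 2 * `|f| * `|x - y| = `|f| * (2 * `|x - y|) by ring.
by move: h5; set q := `|f| * (2 * _); lra.
Qed.


Section Window.
Variables (a CF : R) (rho F psi g : R -> R).
Hypotheses (lrho : loc_integrable a rho) (mF : measurable_fun (halfline a) F).
Hypothesis rho0 : {ae mu, forall x, a < x -> 0 < rho x}.
Hypothesis rhocvg : rho x @[x --> ae_pinfty] --> (0 : R).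
Hypothesis rhoo : forall l : R, 0 < l ->
  (fun x => l^-1 * \int[mu]_(t in `[0, l]) `|rho (x + t) - rho x|) =o_ae_pinfty rho.
Hypothesis ppsi : primitive a psi g.
Hypothesis CF0 : 0 <= CF.
Hypothesis FC : ae_pinfty [set t | `|F t| <= CF].
Hypothesis psiE : forall e, 0 < e ->
  ae_pinfty [set t | `|g t - rho t * slow_field (psi t) (F t)| <= e * rho t].

(** On one window: [rho] is replaced by the constant [m], at the cost of the integral of
    [|rho - m|]; then [psi] moves by at most a multiple of [m], so that the argument of the
    field may be frozen at its initial value.  All errors are small multiples of [m].  As
    the field is affine in [F], integration produces the window mean. *)
Lemma window_step l e : 0 < l -> 0 < e -> exists2 X, a < X & forall x, X <= x ->
  exists m, [/\ 0 < m, m <= e, intg x (x + l) rho <= 2 * l * m,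
    forall t, x <= t <= x + l -> `|psi t - psi x| <= e &
    `|psi (x + l) - psi x - m * l * slow_field (psi x) (window_mean F l x)| <= e * m /\
    `|window_mean F l x| <= CF].
Proof.
move=> l0 e0.
have cf0 := CF0.
have [C1 C1E] : {c : R | c = CF + 2} by eexists.
have [L LE] : {c : R | c = 4 + 2 * CF} by eexists.
have [C2 C2E] : {c : R | c = (C1 + 1) * (1 + l)} by eexists.
have [C3 C3E] : {c : R | c = 1 + C1 + l + L * C2 * l} by eexists.
have C10 : 0 < C1 by lra.
have L0 : 0 < L by lra.
have C20 : 0 < C2 by rewrite C2E mulr_gt0//; lra.
have C30 : 0 < C3.
  have : 0 < L * C2 * l by rewrite !mulr_gt0.
  by lra.
(* [dl] is the precision asked of [rho]; the last two bounds make the displacement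
   [C2 * m] and the total error [C3 * dl * m] at most [e] and [e * m] *)
pose dl := Num.min (Num.min 1 l) (Num.min e (Num.min (e / C2) (e / C3))).
have dl0 : 0 < dl by rewrite !lt_min ltr01 l0 e0 !divr_gt0.
have dl1 : dl <= 1 by rewrite !ge_min lexx.
have dll : dl <= l by rewrite !ge_min lexx !orbT.
have dle : dl <= e by rewrite !ge_min lexx !orbT.
have dle2 : C2 * dl <= e by rewrite mulrC -ler_pdivlMr// !ge_min lexx !orbT.
have dle3 : C3 * dl <= e by rewrite mulrC -ler_pdivlMr// !ge_min lexx !orbT.
have [X aX hX] := slowly_varying lrho rho0 rhocvg rhoo l0 dl0.
have [M1 hM1] := FC; have [M2 hM2] := psiE dl0.
pose M := Num.max X (Num.max M1 M2 + 1).
have XM : X <= M by rewrite le_max lexx.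
have MM1 : M1 < M.
  by apply: (@lt_le_trans _ _ (M1 + 1)); [rewrite ltrDl|rewrite le_max lerD2r le_max lexx orbT].
have MM2 : M2 < M.
  by apply: (@lt_le_trans _ _ (M2 + 1)); [rewrite ltrDl|rewrite le_max lerD2r le_max lexx !orbT].
exists M; first exact: lt_le_trans XM.
move=> x Mx; have ax : a < x by lra.
have xl : x <= x + l by lra.
have [m [m0 mdl hm]] := hX x ltac:(lra).
have lpsi := prim_lint ppsi.
have irho : itv_integrable x (x + l) rho by exact: lrho.
have ig := lpsi x (x + l) ax.
have aeW (P : R -> Prop) : {ae mu, forall t, x <= t -> P t} -> {ae mu, forall t, x <= t <= x + l -> P t}.
  by apply: filterS => t h /andP[/h].
have aeF : {ae mu, forall t, x <= t -> `|F t| <= CF}.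
  by apply: filterS hM1 => t h xt; apply: h; lra.
have aeP : {ae mu, forall t, x <= t -> `|g t - rho t * slow_field (psi t) (F t)| <= dl * rho t}.
  by apply: filterS hM2 => t h xt; apply: h; lra.
have aer : {ae mu, forall t, x <= t -> 0 < rho t}.
  by apply: filterS rho0 => t h xt; apply: h; lra.
have iF : itv_integrable x (x + l) F.
  apply: intbl_ae_bound CF0 _ (aeW _ aeF).
  apply: measurable_funS mF => //; first exact: measurable_itv.
  by move=> t /=; rewrite /halfline /= !in_itv/= andbT => /andP[xt _]; lra.
have irm : itv_integrable x (x + l) (fun t => `|rho t - m|).
  by apply: intbl_norm; apply: intblB => //; exact: intbl_cst.
have intrho : intg x (x + l) rho <= dl * m + m * l.
  have -> : dl * m + m * l = dl * m + m * (x + l - x) by ring.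
  rewrite -int_cst//.
  apply: (@le_trans _ _ (intg x (x + l) (fun t => `|rho t - m| + m))).
    apply: le_int => //; first by apply: intblD => //; exact: intbl_cst.
    by move=> t _; have := ler_norm (rho t - m); lra.
  by rewrite intD ?lerD2r//; exact: intbl_cst.
have dlm : dl * m <= m by rewrite ger_pMl.
have dlm' : dl * m <= l * m by rewrite ler_pM2r.
have psit t : x <= t <= x + l -> `|psi t - psi x| <= C2 * m.
  move=> /andP[xt tl]; have [_ ->//] := ppsi.
  apply: (@le_trans _ _ (intg x t (fun s => (C1 + 1) * `|rho s|))).
    apply: norm_int_le_ae; [exact: lpsi|by apply: intblZ; apply: intbl_norm; exact: lrho|].
    apply: filterS (aeI aeF (aeI aeP aer)) => s [h1 [h2 h3]] /andP[xs _].
    have {}h1 := h1 xs; have {}h2 := h2 xs; have {}h3 := h3 xs.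
    have -> : g s = (g s - rho s * slow_field (psi s) (F s)) + rho s * slow_field (psi s) (F s) by ring.
    apply: le_trans (ler_normD _ _) _; rewrite normrM (gtr0_norm h3) mulrDl mul1r addrC.
    apply: lerD.
      rewrite mulrC ler_wpM2r ?(ltW h3)//; apply: le_trans (slow_field_bound _ _) _.
      lra.
    by apply: le_trans h2 _; rewrite ger_pMl.
  rewrite intZ; last by apply: intbl_norm; exact: lrho.
  rewrite C2E -mulrA ler_wpM2l//; first by lra.
  apply: (@le_trans _ _ (intg x (x + l) (fun s => `|rho s|))).
    by apply: int_mono; rewrite ?lexx//; exact: intbl_norm.
  rewrite (@int_ae_eq _ _ _ _ rho)//; last 2 first.
  - exact: intbl_norm.
  - by apply: filterS aer => s h /andP[/h h' _]; rewrite gtr0_norm.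
  by apply: le_trans intrho _; rewrite mulrDl mul1r [l * m]mulrC; lra.
have C2m : C2 * m <= C2 * dl by rewrite ler_pM2l.
exists m; split => //.
- by lra.
- by apply: le_trans intrho _; rewrite mulrAC [m * l]mulrC; lra.
- by move=> t /psit h; lra.
have FmE : l * window_mean F l x = intg x (x + l) F.
  by rewrite /window_mean mulrA divff ?mul1r// gt_eqF.
split; last first.
  rewrite /window_mean normrM gtr0_norm ?invr_gt0// -ler_pdivlMl ?invr_gt0// invrK.
  have -> : l * CF = CF * (x + l - x) by ring.
  rewrite -int_cst//; apply: norm_int_le_ae => //; first exact: intbl_cst.
  exact: aeW.
pose S := sin (psi x) * cos (psi x) - sin (psi x) ^+ 2.
pose h t := m * (S + F t * cos (psi x) ^+ 2).
have hE t : h t = m * slow_field (psi x) (F t) by [].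
have ih0 : itv_integrable x (x + l) (fun t => S + cos (psi x) ^+ 2 * F t).
  by apply: intblD; [exact: intbl_cst|exact: intblZ].
have ih : itv_integrable x (x + l) h.
  rewrite /h; under eq_fun do rewrite mulrC [F _ * _]mulrC mulrC.
  by apply: intblZ.
have inth : intg x (x + l) h = m * l * slow_field (psi x) (window_mean F l x).
  have -> : h = (fun t => m * (S + cos (psi x) ^+ 2 * F t)).
    by apply/funext => t; rewrite /h [F t * _]mulrC.
  rewrite intZ// intD; [|exact: intbl_cst|exact: intblZ].
  rewrite intZ// int_cst// -FmE /slow_field -/S; ring.
have [_ ->//] := ppsi.
rewrite -inth -intB//.
apply: (@le_trans _ _ (intg x (x + l) (fun t => (dl + C1) * `|rho t - m| + (dl * m + m * (L * (C2 * m)))))).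
  apply: norm_int_le_ae; first exact: intblB.
    by apply: intblD; [exact: intblZ|exact: intbl_cst].
  apply: filterS (aeI aeF (aeI aeP aer)) => s [h1 [h2 h3]] xsl.
  have /andP[xs _] := xsl.
  have {}h1 := h1 xs; have {}h2 := h2 xs; have {}h3 := h3 xs.
  have h4 := psit s xsl.
  have -> : g s - h s = (g s - rho s * slow_field (psi s) (F s)) +
    ((rho s - m) * slow_field (psi s) (F s) +
     m * (slow_field (psi s) (F s) - slow_field (psi x) (F s))) by rewrite hE; ring.
  apply: le_trans (ler_normD _ _) _.
  have b1 : `|(rho s - m) * slow_field (psi s) (F s)| <= C1 * `|rho s - m|.
    rewrite normrM mulrC ler_wpM2r//; apply: le_trans (slow_field_bound _ _) _.
    lra.
  have b2 : `|m * (slow_field (psi s) (F s) - slow_field (psi x) (F s))| <= m * (L * (C2 * m)).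
    rewrite normrM (gtr0_norm m0) ler_pM2l//.
    apply: le_trans (slow_field_lipschitz _ _ _) _.
    have q0 : 0 <= `|F s| by [].
    by apply: ler_pM => //; lra.
  have b3 : dl * rho s <= dl * `|rho s - m| + dl * m.
    by rewrite -mulrDr ler_pM2l//; have := ler_norm (rho s - m); lra.
  have b4 := ler_normD ((rho s - m) * slow_field (psi s) (F s))
    (m * (slow_field (psi s) (F s) - slow_field (psi x) (F s))).
  rewrite [(dl + C1) * _]mulrDl.
  move: b1 b2 b3 b4 h2; set q1 := _ * slow_field (psi s) (F s); set q2 := m * (_ - _).
  set q3 := dl * `|_|; set q4 := C1 * _; set q5 := m * (L * _); set q6 := dl * m; set q7 := dl * rho s.
  by move=> *; lra.
rewrite intD; [|exact: intblZ|exact: intbl_cst].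
rewrite intZ// int_cst//.
have -> : x + l - x = l by ring.
apply: (@le_trans _ _ ((dl + C1) * (dl * m) + (dl * m + m * (L * (C2 * dl))) * l)).
  apply: lerD; first by rewrite ler_wpM2l// addr_ge0 ?ltW.
  apply: ler_wpM2r; first exact: ltW.
  by rewrite lerD2l !ler_pM2l.
apply: (@le_trans _ _ (C3 * dl * m)); last by rewrite ler_wpM2r// ltW.
have -> : C3 * dl * m = dl * m + C1 * (dl * m) + (dl * m + m * (L * (C2 * dl))) * l.
  by rewrite C3E; ring.
rewrite lerD2r mulrDl lerD2r.
by rewrite ler_piMl// mulr_ge0// ltW.
Qed.

End Window.

End Averaging.

(** * Long time behaviour of a slowly moving angle *)

Section SlowMotion.
Context {R : realType}.
Implicit Types (a b x y z s t c d e l m v B X CF : R) (f g rho F psi : R -> R).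
Local Notation mu := (@lebesgue_measure R).

(** What [window_step] says about [psi]: during a window it moves little, and by the
    amount that the field predicts from the window mean.  The factor [m] is the duration
    per unit length in the time log |beta|. *)
Definition slow_motion a CF rho F psi :=
  forall l e, 0 < l -> 0 < e -> exists2 X, a < X & forall x, X <= x ->
  exists m, [/\ 0 < m, m <= e, intg x (x + l) rho <= 2 * l * m,
    forall t, x <= t <= x + l -> `|psi t - psi x| <= e &
    `|psi (x + l) - psi x - m * l * slow_field (psi x) (window_mean F l x)| <= e * m /\
    `|window_mean F l x| <= CF].

Lemma slow_field_mono th (f g : R) : f <= g -> slow_field th f <= slow_field th g.
Proof. by move=> fg; rewrite lerD2l ler_wpM2r// sqr_ge0. Qed.

(** The field at [f = - 1/4 - d] is minus the positive definite form
    [(s - c / 2) ^+ 2 + d * c ^+ 2], bounded below on the unit circle. *)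
Lemma slow_field_subcritical d : 0 < d -> exists2 k, 0 < k &
  forall th, slow_field th (- (1 / 4) - d) <= - k.
Proof.
(* this [k] makes [k * (2 * u + 3 / 2 * c ^+ 2) <= u + d * c ^+ 2] *)
move=> d0; pose k := Num.min (1 / 2) (2 * d / 3).
have k0 : 0 < k by rewrite lt_min !divr_gt0// mulr_gt0.
have k1 : k <= 1 / 2 by rewrite ge_min lexx.
have k2 : k <= 2 * d / 3 by rewrite ge_min lexx orbT.
exists k => // th; have := cos2Dsin2 th; rewrite /slow_field.
set c := cos th; set s := sin th => sc.
have c2 : 0 <= c ^+ 2 by exact: sqr_ge0.
have u2 : 0 <= (s - c / 2) ^+ 2 by exact: sqr_ge0.
have h : 1 <= 2 * (s - c / 2) ^+ 2 + 3 / 2 * c ^+ 2.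
  have h0 : 0 <= (s - c) ^+ 2 by exact: sqr_ge0.
  have h1 : 2 * (s - c / 2) ^+ 2 + 3 / 2 * c ^+ 2 - (c ^+ 2 + s ^+ 2) = (s - c) ^+ 2 by field.
  by rewrite -h1 sc in h0; lra.
have e : s * c - s ^+ 2 + (- (1 / 4) - d) * c ^+ 2 = - ((s - c / 2) ^+ 2 + d * c ^+ 2) by field.
rewrite e lerN2; move: u2 h; set u := (s - c / 2) ^+ 2 => u2 h.
by nra.
Qed.

(** Every window lowers [psi] by a fixed proportion of the integral of [rho] over it. *)
Lemma slow_motion_decreasing a CF rho F psi l d X0 : slow_motion a CF rho F psi ->
  loc_integrable a rho -> {ae mu, forall x, a < x -> 0 < rho x} ->
  0 < l -> 0 < d -> (forall x, X0 <= x -> window_mean F l x <= - (1 / 4) - d) ->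
  (forall B X, a < X -> exists2 y, X <= y & B <= intg X y rho) ->
  forall B X, exists2 x, X <= x & psi x <= B.
Proof.
move=> sm lrho rho0 l0 d0 hF unb B X.
have [k k0 hk] := slow_field_subcritical d0.
(* half of the predicted decrease [k * m * l] pays for the error of a window *)
have kl0 : 0 < k * l / 2 by rewrite divr_gt0// mulr_gt0.
have [X1 aX1 hX1] := sm _ _ l0 kl0.
pose x0 := Num.max X1 (Num.max X0 X).
have X1x0 : X1 <= x0 by rewrite le_max lexx.
have X0x0 : X0 <= x0 by rewrite !le_max lexx orbT.
have Xx0 : X <= x0 by rewrite !le_max lexx !orbT.
have ax0 : a < x0 by exact: lt_le_trans X1x0.
have step x : x0 <= x -> psi (x + l) - psi x <= - (k / 4 * intg x (x + l) rho).
  move=> x0x; have [m [m0 me hint hosc [hm hF']]] := hX1 x (le_trans X1x0 x0x).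
  have h1 := slow_field_mono (psi x) (hF x (le_trans X0x0 x0x)).
  have h2 := hk (psi x).
  have ml : 0 < m * l by rewrite mulr_gt0.
  have h3 : m * l * slow_field (psi x) (window_mean F l x) <= m * l * (- k).
    by rewrite ler_pM2l//; lra.
  have h4 : k / 4 * intg x (x + l) rho <= k / 4 * (2 * l * m) by rewrite ler_pM2l// divr_gt0.
  move: hm; rewrite ler_norml => /andP[_ hm].
  have e1 : k * l / 2 * m = m * l * k / 2 by field.
  have e2 : k / 4 * (2 * l * m) = m * l * k / 2 by field.
  by move: h3; rewrite mulrN; move: hm h4; rewrite e1 e2; lra.
have iter n : psi (x0 + l * n%:R) - psi x0 <= - (k / 4 * intg x0 (x0 + l * n%:R) rho) .
  elim: n => [|n ih]; first by rewrite mulr0 addr0 int_pt mulr0 oppr0 subrr.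
  have ln : 0 <= l * n%:R by rewrite mulr_ge0// ltW.
  have := step (x0 + l * n%:R) ltac:(lra).
  have -> : x0 + l * n%:R + l = x0 + l * n.+1%:R by rewrite -natr1; ring.
  move=> st; rewrite (@int_split _ x0 (x0 + l * n%:R)); last 3 first.
  - lra.
  - by rewrite lerD2l ler_pM2l// ler_nat.
  - exact: lrho.
  by rewrite mulrDr; move: ih st; lra.
have [y x0y hy] := unb ((psi x0 - B) * 4 / k) x0 ax0.
pose n := (Num.truncn ((y - x0) / l)).+1.
have yn : y <= x0 + l * n%:R.
  have : (y - x0) / l < n%:R by exact: truncnS_gt.
  by rewrite ltr_pdivrMr// mulrC; lra.
exists (x0 + l * n%:R); first by lra.
have := iter n.
rewrite (@int_split _ x0 y)//; last exact: lrho.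
have : 0 <= intg y (x0 + l * n%:R) rho.
  have := int_cst 0 yn; rewrite mul0r => <-.
  apply: le_int_ae; [exact: intbl_cst|by apply: lrho; lra|].
  by apply: filterS rho0 => t h /andP[yt _]; apply/ltW/h; lra.
have : k / 4 * ((psi x0 - B) * 4 / k) <= k / 4 * intg x0 y rho by rewrite ler_pM2l// divr_gt0.
have -> : k / 4 * ((psi x0 - B) * 4 / k) = psi x0 - B by field; rewrite gt_eqF.
set i1 := intg x0 y rho; set i2 := intg y _ rho => h1 h2.
have : 0 <= k / 4 * i2 by rewrite mulr_ge0// divr_ge0// ltW.
by rewrite mulrDr; lra.
Qed.

(** A function that moves by at most [e] per window and does not decrease over windows
    starting in [[b, b + e]] is still above [b] at the ends of successive windows if it
    starts there; in between it loses at most [e]. *)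
Lemma barrier psi X l b e x0 : 0 < l -> X <= x0 ->
  (forall x, X <= x -> forall t, x <= t <= x + l -> `|psi t - psi x| <= e) ->
  (forall x, X <= x -> b <= psi x <= b + e -> psi x <= psi (x + l)) ->
  b <= psi x0 -> forall x, x0 <= x -> b - e <= psi x.
Proof.
move=> l0 Xx0 osc stay b0.
have iter n : b <= psi (x0 + l * n%:R).
  elim: n => [|n ih]; first by rewrite mulr0 addr0.
  have ln : 0 <= l * n%:R by rewrite mulr_ge0// ltW.
  have -> : x0 + l * n.+1%:R = x0 + l * n%:R + l by rewrite -natr1; ring.
  have [h|h] := leP (psi (x0 + l * n%:R)) (b + e).
    by apply: (le_trans ih); apply: stay; [lra|rewrite ih].
  have := osc (x0 + l * n%:R) ltac:(lra) (x0 + l * n%:R + l).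
  rewrite lexx lerDl (ltW l0) => /(_ isT).
  by rewrite ler_norml => /andP[h1 _]; lra.
move=> x x0x.
pose n := Num.truncn ((x - x0) / l).
have xx0 : 0 <= (x - x0) / l by rewrite divr_ge0 ?subr_ge0// ltW.
have /andP[n1 n2] := truncn_itv xx0.
rewrite ler_pdivlMr// mulrC in n1.
rewrite ltr_pdivrMr// mulrC -natr1 in n2.
have ln : 0 <= l * n%:R by rewrite mulr_ge0// ltW.
have := osc (x0 + l * n%:R) ltac:(lra) x.
have -> : x0 + l * n%:R <= x <= x0 + l * n%:R + l.
  by move: n2; rewrite mulrDr mulr1 => n2; apply/andP; split; lra.
move=> /(_ isT); rewrite ler_norml => /andP[h1 _].
by have := iter n; lra.
Qed.

Lemma sin_cosD2pin x n :
  sin (x + pi *+ 2 *+ n) = sin x /\ cos (x + pi *+ 2 *+ n) = cos x.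
Proof.
elim: n => [|n [h1 h2]]; first by rewrite mulr0n addr0.
by rewrite mulrSr addrA sinD2pi cosD2pi.
Qed.

Lemma shift_above x v : exists n, v <= x + pi *+ 2 *+ n.
Proof.
have pi1 : 1 <= pi *+ 2 :> R by have := pi_ge2 R; rewrite mulr2n; lra.
exists (Num.truncn (v - x)).+1.
have : v - x < (Num.truncn (v - x)).+1%:R by exact: truncnS_gt.
set n := _.+1 => h.
have : n%:R <= pi *+ 2 *+ n :> R.
  by rewrite -[leRHS]mulr_natr -[leLHS]mul1r ler_wpM2r.
by lra.
Qed.

Lemma shift_below x v : exists2 y, y <= v & sin y = sin x /\ cos y = cos x.
Proof.
have [n hn] := shift_above (- x) (- v).
exists (x - pi *+ 2 *+ n); first lra.
by have [] := sin_cosD2pin (x - pi *+ 2 *+ n) n; rewrite subrK => -> ->.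
Qed.

(** At slope 1/2 the field equals [(f + 1/4) * cos ^+ 2], positive for means above -1/4, and at the
    vertical direction it equals [-1] whatever [f] is.  Both signs persist nearby, so the
    angles of these directions are barriers, the first from below and the second from
    above. *)
Lemma slow_motion_bounded a CF rho F psi l d X0 : slow_motion a CF rho F psi ->
  0 < l -> 0 < d -> (forall x, X0 <= x -> - (1 / 4) + d <= window_mean F l x) ->
  exists2 X, a < X & exists M, forall x, X <= x -> `|psi x| <= M.
Proof.
move=> sm l0 d0 hF.
have [L1 L1E] : {c : R | c = 4 + 2 * `|- (1 / 4) + d|} by eexists.
have [L2 L2E] : {c : R | c = 4 + 2 * `|CF|} by eexists.
have L10 : 0 < L1 by rewrite L1E ltr_wpDr// mulr_ge0.
have L20 : 0 < L2 by rewrite L2E ltr_wpDr// mulr_ge0.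
(* within [e] of a barrier the field keeps half of its value there, which is at least
   [4 * d / 5] at the lower barrier and equal to [-1] at the upper one; that half,
   times [l * m], covers the error [e * m] of a window *)
pose e := Num.min (Num.min (2 * d / 5 / L1) (1 / 2 / L2)) (Num.min (2 * d / 5 * l) (1 / 2 * l)).
have e0 : 0 < e by rewrite !lt_min !(divr_gt0, mulr_gt0).
have e1 : L1 * e <= 2 * d / 5 by rewrite mulrC -ler_pdivlMr// !ge_min lexx.
have e2 : L2 * e <= 1 / 2 by rewrite mulrC -ler_pdivlMr// !ge_min lexx !orbT.
have e3 : e <= 2 * d / 5 * l by rewrite !ge_min lexx !orbT.
have e4 : e <= 1 / 2 * l by rewrite !ge_min lexx !orbT.
have [X1 aX1 hX1] := sm _ _ l0 e0.
pose X := Num.max X0 X1.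
have X0X : X0 <= X by rewrite le_max lexx.
have X1X : X1 <= X by rewrite le_max lexx orbT.
exists X; first exact: lt_le_trans X1X.
have osc x : X <= x -> forall t, x <= t <= x + l -> `|psi t - psi x| <= e.
  by move=> Xx; have [m []] := hX1 x (le_trans X1X Xx).
pose b0 : R := atan (1 / 2).
have sb0 : sin b0 = cos b0 / 2.
  have := atanK (1 / 2 : R); rewrite -/b0 /tan => h.
  have c0 : cos b0 != 0.
    by apply/eqP => c0; move: h; rewrite c0 invr0 mulr0 => /eqP; rewrite eq_sym; apply/negP; rewrite gt_eqF// divr_gt0.
  by move: h => /(congr1 ( *%R^~ (cos b0))); rewrite mulfVK// => ->; field.
have [b bX [sbb cbb]] := shift_below b0 (psi X).
have sb : sin b = cos b / 2 by rewrite sbb cbb.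
have cb : cos b ^+ 2 = 4 / 5.
  have := cos2Dsin2 b; rewrite sb exprMn => h.
  have h5 : cos b ^+ 2 + cos b ^+ 2 * 2^-1 ^+ 2 = 5 / 4 * cos b ^+ 2 by field.
  by rewrite h5 in h; lra.
have low x : X <= x -> b - e <= psi x.
  apply: (barrier l0 (lexx X) osc) => // y Xy /andP[by1 by2].
  have [m [m0 me _ _ [hm _]]] := hX1 y (le_trans X1X Xy).
  have h1 := slow_field_mono (psi y) (hF y (le_trans X0X Xy)).
  have h2 := slow_field_lipschitz (psi y) b (- (1 / 4) + d).
  have h3 : slow_field b (- (1 / 4) + d) = 4 / 5 * d.
    rewrite /slow_field sb; have -> : cos b / 2 * cos b - (cos b / 2) ^+ 2 +
      (- (1 / 4) + d) * cos b ^+ 2 = d * cos b ^+ 2 by field.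
    by rewrite cb mulrC.
  have h4 : `|psi y - b| <= e by rewrite ger0_norm; lra.
  rewrite -L1E in h2.
  have h5 : L1 * `|psi y - b| <= L1 * e by rewrite ler_pM2l.
  move: h2; rewrite ler_norml => /andP[h2 _].
  have h6 : 2 * d / 5 <= slow_field (psi y) (window_mean F l y) by lra.
  have ml : 0 < m * l by rewrite mulr_gt0.
  have h7 : m * l * (2 * d / 5) <= m * l * slow_field (psi y) (window_mean F l y) by rewrite ler_pM2l.
  have h8 : e * m <= 2 * d / 5 * l * m by rewrite ler_pM2r.
  move: hm; rewrite ler_norml => /andP[hm _].
  have e5 : m * l * (2 * d / 5) = 2 * d / 5 * l * m by ring.
  rewrite e5 in h7; lra.
have [n hn] := shift_above (pi / 2) (psi X).
set b' := pi / 2 + _ in hn.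
have [sb' cb'] : sin b' = 1 /\ cos b' = 0.
  by have [] := sin_cosD2pin (pi / 2) n; rewrite -/b' sin_pihalf cos_pihalf.
have up x : X <= x -> - b' - e <= - psi x.
  apply: (@barrier (fun x => - psi x) X l (- b') e X l0 (lexx X)).
  - by move=> y Xy t /(osc y Xy); rewrite -opprD normrN.
  - move=> y Xy /andP[by1 by2].
    have [m [m0 me _ _ [hm hC]]] := hX1 y (le_trans X1X Xy).
    have h1 : slow_field (psi y) (window_mean F l y) <= slow_field (psi y) CF.
      by apply: slow_field_mono; apply: le_trans hC; exact: ler_norm.
    have h2 := slow_field_lipschitz (psi y) b' CF.
    have h3 : slow_field b' CF = -1.
      by rewrite /slow_field sb' cb' mulr0 expr0n/= mulr0 expr1n; ring.
    have h4 : `|psi y - b'| <= e by rewrite ler0_norm; lra.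
    rewrite -L2E in h2.
    have h5 : L2 * `|psi y - b'| <= L2 * e by rewrite ler_pM2l.
    move: h2; rewrite ler_norml => /andP[_ h2].
    have h6 : slow_field (psi y) (window_mean F l y) <= - (1 / 2) by lra.
    have ml : 0 < m * l by rewrite mulr_gt0.
    have h7 : m * l * slow_field (psi y) (window_mean F l y) <= m * l * - (1 / 2) by rewrite ler_pM2l.
    have h8 : e * m <= 1 / 2 * l * m by rewrite ler_pM2r.
    move: hm; rewrite ler_norml => /andP[_ hm].
    have e5 : m * l * - (1 / 2) = - (1 / 2 * l * m) by ring.
    rewrite e5 in h7; lra.
  - by rewrite lerN2.
exists (`|b| + `|b'| + e) => x Xx; rewrite ler_norml.
have := low x Xx; have := up x Xx.
have := ler_norm b'; have := ler_norm (- b); rewrite normrN.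
have := normr_ge0 b; have := normr_ge0 b'.
by move=> *; apply/andP; split; lra.
Qed.

End SlowMotion.

(** * Counting and window means *)

Section RelativeCount.
Context {R : realType}.
Implicit Types (a b x y z s t c d e l m v B X M N : R) (f g theta : R -> R).
Local Notation mu := (@lebesgue_measure R).

Lemma limf_esup_bounds (I : choiceType) (T : filteredType I) (F : set_system T) (PF : ProperFilter F)
  (f : T -> R) (N : R) :
  (\forall w \near F, `|f w| <= N) ->
  ((- N)%:E <= limf_esup (fun w => (f w)%:E) F <= N%:E)%E.
Proof.
move=> fN; rewrite limf_esupE; apply/andP; split.
  apply: le_ereal_inf_tmp => _ [V FV <-].
  have [x [Vx fx]] := filter_ex (filterI FV fN).
  apply: (@le_trans _ _ (f x)%:E).
    by rewrite lee_fin; move: fx; rewrite ler_norml => /andP[].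
  by apply: ereal_sup_ubound; exists x.
apply: (@le_trans _ _ (ereal_sup [set (f w)%:E | w in [set w | `|f w| <= N]])).
  by apply: ereal_inf_lbound; eexists; first exact: fN.
apply: ge_ereal_sup => _ [x /= fx <-]; rewrite lee_fin.
by apply: le_trans fx; exact: ler_norm.
Qed.

Lemma limf_fin_num (I : choiceType) (T : filteredType I) (F : set_system T) (PF : ProperFilter F)
  (f : T -> R) (N : R) :
  (\forall w \near F, `|f w| <= N) ->
  limf_einf (fun w => (f w)%:E) F \is a fin_num /\
  limf_esup (fun w => (f w)%:E) F \is a fin_num.
Proof.
move=> fN; have between (x : \bar R) : ((- N)%:E <= x <= N%:E)%E -> x \is a fin_num.
  move=> /andP[h1 h2]; rewrite fin_numElt (lt_le_trans _ h1) ?ltNyr//=.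
  by rewrite (le_lt_trans h2)// ltry.
split; last exact/between/limf_esup_bounds.
rewrite /limf_einf fin_numN; apply: between.
have -> : (\- (fun w => (f w)%:E))%E = (fun w => (- f w)%:E) by [].
by apply: limf_esup_bounds; apply: filterS fN => x; rewrite normrN.
Qed.

Lemma limf_esup_pinfty (I : choiceType) (T : filteredType I) (F : set_system T) (f : T -> R) :
  (forall N V, F V -> exists2 w, V w & N <= f w) ->
  limf_esup (fun w => (f w)%:E) F = +oo%E.
Proof.
move=> h; apply/eqP; rewrite -leye_eq limf_esupE.
apply: le_ereal_inf_tmp => _ [V FV <-].
rewrite leye_eq; apply/eqP/eqyP => M M0.
have [x Vx Mx] := h M V FV.
by apply: (@le_trans _ _ (f x)%:E); [rewrite lee_fin|apply: ereal_sup_ubound; exists x].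
Qed.

(** Up to 1 the relative count is the increase of the angle difference in units of [pi]. *)
Lemma rel_count_bounds (theta0 theta1 : R -> R) c d :
  (theta1 d - theta0 d - (theta1 c - theta0 c)) / pi - 1 <=
    ((rel_count theta0 theta1 (c, d))%:~R : R) <=
  (theta1 d - theta0 d - (theta1 c - theta0 c)) / pi + 1.
Proof.
rewrite /rel_count/= !rmorphB/= mulr1z mulrBl.
set x := (theta1 d - _) / pi; set y := (theta1 c - _) / pi.
have /andP[h1 h2] := ceil_itv x; have /andP[h3 h4] := floor_itv y.
rewrite rmorphB/= mulr1z in h1; rewrite rmorphD/= mulr1z in h4.
by apply/andP; split; lra.
Qed.

#[local] Instance rel_count_filter a : ProperFilter (filter_prod (a^'+ : set_system R) (pinfty_nbhs R)).
Proof. exact: filter_prod_proper. Qed.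

Lemma near_a_infty a X : \forall cd \near filter_prod (a^'+ : set_system R) (pinfty_nbhs R),
  [/\ a < cd.1, cd.1 < a + 1 & X < cd.2].
Proof.
exists ([set c | a < c /\ c < a + 1], [set d | X < d]) => /=.
  split; last by apply: nbhs_pinfty_gt; rewrite num_real.
  by apply: filterI; [exact: nbhs_right_gt|apply: nbhs_right_lt; rewrite ltrDl].
by move=> [c d] /= [[h1 h2] h3].
Qed.

Lemma rel_count_bounded a (theta0 theta1 : R -> R) M :
  (forall x, a < x -> `|theta1 x - theta0 x| <= M) ->
  rel_count_inf a theta0 theta1 \is a fin_num /\
  rel_count_sup a theta0 theta1 \is a fin_num.
Proof.
move=> hM; apply: (@limf_fin_num _ _ _ _ _ (2 * M / pi + 1)).
apply: filterS (near_a_infty a a) => -[c d] /= [ac _ ad].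
have /andP[h1 h2] := rel_count_bounds theta0 theta1 c d.
have hd := hM d ad; have hc := hM c ac.
have p0 : 0 < pi^-1 :> R by rewrite invr_gt0 pi_gt0.
have : `|(theta1 d - theta0 d - (theta1 c - theta0 c)) / pi| <= 2 * M / pi.
  rewrite normrM (gtr0_norm p0) ler_pM2r//.
  by apply: le_trans (ler_normB _ _) _; lra.
rewrite ler_norml => /andP[h3 h4].
by rewrite ler_norml; apply/andP; split; lra.
Qed.

Lemma rel_count_unbounded_up a (theta0 theta1 : R -> R) M :
  (forall c, a < c -> c < a + 1 -> `|theta1 c - theta0 c| <= M) ->
  (forall N X, exists2 d, X < d & N <= theta1 d - theta0 d) ->
  rel_count_sup a theta0 theta1 = +oo%E.
Proof.
move=> hM unb; apply: limf_esup_pinfty => N V [[P Q] [/= aP /= Qoo] PQV].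
have aP1 : a^'+ [set c | [/\ P c, a < c & c < a + 1]].
  apply: filterS3 aP (nbhs_right_gt a) (nbhs_right_lt (ltr_pwDr ltr01 (lexx a))) => c.
  by split.
have [c [Pc ac ca]] := filter_ex aP1.
have [X [_ XQ]] := Qoo.
have [d Xd hd] := unb ((N + 1) * pi + M) X.
exists (c, d); first by apply: PQV; split => //; exact: XQ.
have /andP[h1 _] := rel_count_bounds theta0 theta1 c d.
apply: le_trans h1; rewrite lerBrDr ler_pdivlMr ?pi_gt0//.
by have := hM c ac ca; rewrite ler_norml => /andP[_]; lra.
Qed.

Lemma rel_count_unbounded_down a (theta0 theta1 : R -> R) M :
  (forall c, a < c -> c < a + 1 -> `|theta1 c - theta0 c| <= M) ->
  (forall N X, exists2 d, X < d & theta1 d - theta0 d <= N) ->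
  rel_count_inf a theta0 theta1 = -oo%E.
Proof.
move=> hM unb; rewrite /rel_count_inf /limf_einf.
have -> : (\- (fun cd : R * R => ((rel_count theta0 theta1 cd)%:~R)%:E))%E =
  (fun cd => (- (rel_count theta0 theta1 cd)%:~R : R)%:E) by [].
rewrite limf_esup_pinfty// => N V [[P Q] [/= aP /= Qoo] PQV].
have aP1 : a^'+ [set c | [/\ P c, a < c & c < a + 1]].
  apply: filterS3 aP (nbhs_right_gt a) (nbhs_right_lt (ltr_pwDr ltr01 (lexx a))) => c.
  by split.
have [c [Pc ac ca]] := filter_ex aP1.
have [X [_ XQ]] := Qoo.
have [d Xd hd] := unb (- ((N + 1) * pi + M)) X.
exists (c, d); first by apply: PQV; split => //; exact: XQ.
have /andP[_ h1] := rel_count_bounds theta0 theta1 c d.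
rewrite lerNr; apply: le_trans h1 _; rewrite -lerBrDr ler_pdivrMr ?pi_gt0//.
by have := hM c ac ca; rewrite ler_norml => /andP[h2 _]; lra.
Qed.

Lemma inf_limsup_lt f v : (inf_limsup_mean f < v%:E)%E ->
  exists l d X, [/\ 0 < l, 0 < d & forall x, X <= x -> window_mean f l x <= v - d].
Proof.
move=> /ereal_inf_lt[_ [l /= l0 <-]].
rewrite limf_esupE => /ereal_inf_lt[_ [V [X [_ XV]] <-]].
set S := ereal_sup _ => Sv.
have hS x : X < x -> ((window_mean f l x)%:E <= S)%E.
  by move=> Xx; apply: ereal_sup_ubound; exists x => //; exact: XV.
have [s Ss sv] : exists2 s, (S <= s%:E)%E & s < v.
  move: Sv; case: (S) => [s sv|//|_]; first by exists s => //; rewrite -lte_fin.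
  by exists (v - 1) => //; [rewrite leNye|lra].
exists l, (v - s), (X + 1); split => //; first by rewrite subr_gt0.
move=> x Xx; rewrite -lee_fin; have -> : v - (v - s) = s by ring.
by apply: le_trans Ss; apply: hS; lra.
Qed.

Lemma sup_liminf_gt f v : (v%:E < sup_liminf_mean f)%E ->
  exists l d X, [/\ 0 < l, 0 < d & forall x, X <= x -> v + d <= window_mean f l x].
Proof.
move=> /ereal_sup_gt[_ [l /= l0 <-]].
rewrite limf_einfE => /ereal_sup_gt[_ [V [X [_ XV]] <-]].
set S := ereal_inf _ => Sv.
have hS x : X < x -> (S <= (window_mean f l x)%:E)%E.
  by move=> Xx; apply: ereal_inf_lbound; exists x => //; exact: XV.
have [s Ss sv] : exists2 s, (s%:E <= S)%E & v < s.
  move: Sv; case: (S) => [s sv|_|//]; first by exists s => //; rewrite -lte_fin.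
  by exists (v + 1) => //; [rewrite leey|lra].
exists l, (s - v), (X + 1); split => //; first by rewrite subr_gt0.
move=> x Xx; rewrite -lee_fin; have -> : v + (s - v) = s by ring.
by apply: le_trans Ss _; apply: hS; lra.
Qed.

Lemma measurable_invr : measurable_fun [set: R] (fun x : R => x^-1).
Proof.
have -> : [set: R] = [set 0] `|` ~` [set 0] by rewrite setUv.
apply/measurable_funU => //; first exact: measurableC.
split; first exact: measurable_fun_set1.
apply: open_continuous_measurable_fun; first exact/closed_openC/accessible_closed_set1/hausdorff_accessible/Rhausdorff.
by move=> x; rewrite inE => /eqP x0; exact: inv_continuous.
Qed.

End RelativeCount.

(** * Pointwise form of the effective angle equation *)

Section Effective.
Context {R : realType}.
Local Notation mu := (@lebesgue_measure R).

(** Variation of constants in polar coordinates.  Here [S] and [T] collect the terms that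
    contain the defects [a1] and [a2] of the approximation of the second solution by
    [bt] times the first; without them the angular velocity is exactly [rho] times the
    field. *)
Lemma angle_speed_identity (u0 pu0 v0 pv0 A B bt bt' Dq Dp r th : R) :
  bt != 0 -> bt' != 0 -> 0 < r -> A + bt * B = r * cos th -> bt * B = r * sin th ->
  let u1 := A * u0 + B * v0 in
  let pu1 := A * pu0 + B * pv0 in
  let A' := - (Dq * (v0 * u1) + Dp * (pv0 * pu1)) in
  let B' := Dq * (u0 * u1) + Dp * (pu0 * pu1) in
  let y := A + bt * B in let z := bt * B in
  let z' := bt' * B + bt * B' in
  let y' := A' + z' in
  let a1 := v0 - bt * u0 in let a2 := pv0 - bt * pu0 in
  let S := Dq * (u0 * a1) + Dp * (pu0 * a2) in
  let T := (Dq * a1 ^+ 2 + Dp * a2 ^+ 2) / bt in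
  (y * z' - y' * z) / (y ^+ 2 + z ^+ 2) - bt' / bt *
     slow_field th (bt ^+ 2 / bt' * (u0 ^+ 2 * Dq + pu0 ^+ 2 * Dp)) =
  2 * S * (sin th * cos th) + T * sin th ^+ 2.
Proof.
move=> b0 b'0 r0 yE zE /=.
have r1 : r != 0 by rewrite gt_eqF.
have BE : B = r * sin th / bt by rewrite -zE mulrAC divff// mul1r.
have AE : A = r * cos th - r * sin th by rewrite -yE -zE; ring.
have den : (A + bt * B) ^+ 2 + (bt * B) ^+ 2 = r ^+ 2.
  by rewrite yE zE !exprMn -mulrDr cos2Dsin2 mulr1.
rewrite den /slow_field BE AE; move: (cos th) (sin th) => c s.
by field; rewrite r1 b0 b'0.
Qed.

Lemma norm_mul_le (x y p q : R) : `|x| <= p -> `|y| <= q -> `|x * y| <= p * q.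
Proof. by move=> h1 h2; rewrite normrM ler_pM. Qed.

(** The bound on [Dq] and [Dp] is designed for this: times the square of the size [al] of
    the solution and times [bt], it is [rho]. *)
Lemma angle_speed_error (u0 pu0 a1 a2 bt bt' Dq Dp al C M e : R) (th : R) :
  0 < al -> bt != 0 -> 0 < bt' / bt -> 0 <= C -> 0 <= M -> 0 <= e ->
  `|Dq| <= C * `|bt' / (al ^+ 2 * bt ^+ 2)| -> `|Dp| <= C * `|bt' / (al ^+ 2 * bt ^+ 2)| ->
  `|u0| <= M * al -> `|pu0| <= M * al ->
  `|a1| <= e * `|al * bt| -> `|a2| <= e * `|al * bt| ->
  `|2 * (Dq * (u0 * a1) + Dp * (pu0 * a2)) * (sin th * cos th) +
     (Dq * a1 ^+ 2 + Dp * a2 ^+ 2) / bt * sin th ^+ 2| <=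
   (4 * C * M * e + 2 * C * e ^+ 2) * (bt' / bt).
Proof.
move=> al0 b0 rho0 C0 M0 e0 hq hp hu hpu h1 h2.
set rho := bt' / bt in rho0 *.
have nb0 : 0 < `|bt| by rewrite normr_gt0.
have dE : `|bt' / (al ^+ 2 * bt ^+ 2)| = rho / (al ^+ 2 * `|bt|).
  rewrite -(gtr0_norm rho0) /rho normrM normfV normrM 2!normrX (gtr0_norm al0).
  by rewrite normrM normfV; field; rewrite !gt_eqF.
have aE : `|al * bt| = al * `|bt| by rewrite normrM (gtr0_norm al0).
rewrite dE in hq hp; rewrite aE in h1 h2.
set k := rho / (al ^+ 2 * `|bt|) in hq hp.
have s1 := sin_max th; have c1 := cos_max th.
have sc : `|sin th * cos th| <= 1 by rewrite normrM mulr_ile1.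
have ss : `|sin th ^+ 2| <= 1 by rewrite normrX exprn_ile1.
have S1 : `|Dq * (u0 * a1)| <= C * M * e * rho.
  apply: le_trans (norm_mul_le hq (norm_mul_le hu h1)) _.
  by rewrite le_eqVlt; apply/orP; left; apply/eqP; rewrite /k; field; rewrite !gt_eqF.
have S2 : `|Dp * (pu0 * a2)| <= C * M * e * rho.
  apply: le_trans (norm_mul_le hp (norm_mul_le hpu h2)) _.
  by rewrite le_eqVlt; apply/orP; left; apply/eqP; rewrite /k; field; rewrite !gt_eqF.
have T1 : `|Dq * a1 ^+ 2| <= C * e ^+ 2 * rho * `|bt|.
  rewrite expr2; apply: le_trans (norm_mul_le hq (norm_mul_le h1 h1)) _.
  by rewrite le_eqVlt; apply/orP; left; apply/eqP; rewrite /k; field; rewrite !gt_eqF.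
have T2 : `|Dp * a2 ^+ 2| <= C * e ^+ 2 * rho * `|bt|.
  rewrite expr2; apply: le_trans (norm_mul_le hp (norm_mul_le h2 h2)) _.
  by rewrite le_eqVlt; apply/orP; left; apply/eqP; rewrite /k; field; rewrite !gt_eqF.
have SS : `|2 * (Dq * (u0 * a1) + Dp * (pu0 * a2)) * (sin th * cos th)| <= 4 * C * M * e * rho.
  apply: (@le_trans _ _ (2 * (C * M * e * rho + C * M * e * rho) * 1)).
    apply: norm_mul_le => //; rewrite normrM ger0_norm// ler_pM2l//.
    by apply: le_trans (ler_normD _ _) _; exact: lerD.
  by rewrite le_eqVlt; apply/orP; left; apply/eqP; ring.
have TT : `|(Dq * a1 ^+ 2 + Dp * a2 ^+ 2) / bt * sin th ^+ 2| <= 2 * C * e ^+ 2 * rho.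
  apply: (@le_trans _ _ ((C * e ^+ 2 * rho * `|bt| + C * e ^+ 2 * rho * `|bt|) / `|bt| * 1)).
    apply: norm_mul_le => //; rewrite normrM normfV ler_pM2r ?invr_gt0//.
    by apply: le_trans (ler_normD _ _) _; exact: lerD.
  by rewrite le_eqVlt; apply/orP; left; apply/eqP; field; rewrite !gt_eqF.
apply: le_trans (ler_normD _ _) _; rewrite [(_ + _) * rho]mulrDl; exact: lerD.
Qed.

(** With [C] and [M] fixed this bounds the integrand of the criterion; if the solution is
    [o(al)], it shows that the integrand tends to zero. *)
Lemma perturbation_bound (u0 pu0 bt bt' Dq Dp al C M : R) :
  0 < al -> bt != 0 -> 0 < bt' / bt -> 0 <= C -> 0 <= M ->
  `|Dq| <= C * `|bt' / (al ^+ 2 * bt ^+ 2)| -> `|Dp| <= C * `|bt' / (al ^+ 2 * bt ^+ 2)| ->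
  `|u0| <= M * al -> `|pu0| <= M * al ->
  `|bt ^+ 2 / bt' * (u0 ^+ 2 * Dq + pu0 ^+ 2 * Dp)| <= 2 * C * M ^+ 2.
Proof.
move=> al0 b0 rho0 C0 M0 hq hp hu hpu.
have b'0 : bt' != 0 by apply/eqP => b'0; move: rho0; rewrite b'0 mul0r ltxx.
have nb0 : 0 < `|bt| by rewrite normr_gt0.
have nb'0 : 0 < `|bt'| by rewrite normr_gt0.
have dE : `|bt' / (al ^+ 2 * bt ^+ 2)| = `|bt'| / (al ^+ 2 * `|bt| ^+ 2).
  by rewrite normrM normfV normrM 2!normrX (gtr0_norm al0).
rewrite dE in hq hp.
have E1 : `|u0 ^+ 2 * Dq| <= M ^+ 2 * C * `|bt'| / `|bt| ^+ 2.
  rewrite expr2; apply: le_trans (norm_mul_le (norm_mul_le hu hu) hq) _.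
  by rewrite le_eqVlt; apply/orP; left; apply/eqP; field; rewrite !gt_eqF.
have E2 : `|pu0 ^+ 2 * Dp| <= M ^+ 2 * C * `|bt'| / `|bt| ^+ 2.
  rewrite expr2; apply: le_trans (norm_mul_le (norm_mul_le hpu hpu) hp) _.
  by rewrite le_eqVlt; apply/orP; left; apply/eqP; field; rewrite !gt_eqF.
have E3 : `|bt ^+ 2 / bt'| <= `|bt| ^+ 2 / `|bt'| by rewrite normrM normfV normrX.
have E4 : `|u0 ^+ 2 * Dq + pu0 ^+ 2 * Dp| <= M ^+ 2 * C * `|bt'| / `|bt| ^+ 2 + M ^+ 2 * C * `|bt'| / `|bt| ^+ 2.
  by apply: le_trans (ler_normD _ _) _; exact: lerD.
apply: le_trans (norm_mul_le E3 E4) _.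
by rewrite le_eqVlt; apply/orP; left; apply/eqP; field; rewrite !gt_eqF.
Qed.

End Effective.

(** * The relative oscillation criterion *)

Section RelativeOscillation.
Context {R : realType}.
Local Notation mu := (@lebesgue_measure R).
Variables (a : R) (p0 q0 p1 q1 r : R -> R) (phi E : R)
  (u0 pu0 v0 pv0 alpha beta beta' : R -> R).
Hypotheses (coef0 : sl_coefficients a p0 q0 r) (coef1 : sl_coefficients a p1 q1 r)
  (reg0 : regular_at_left a p0 q0 r) (reg1 : regular_at_left a p1 q1 r)
  (adm : admissible a p0 q0 r phi E u0 pu0 v0 pv0 alpha beta beta').

Let Dq x := q1 x - q0 x.
Let Dp x := (p0 x)^-1 - (p1 x)^-1.
Let F t := (beta t) ^+ 2 / beta' t * ((u0 t) ^+ 2 * Dq t + (pu0 t) ^+ 2 * Dp t).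
Let rho x := beta' x / beta x.

Hypothesis DqO : Dq =O_ae_pinfty (fun x => beta' x / ((alpha x) ^+ 2 * (beta x) ^+ 2)).
Hypothesis DpO : Dp =O_ae_pinfty (fun x => beta' x / ((alpha x) ^+ 2 * (beta x) ^+ 2)).

Let P0 t := (p0 t)^-1.
Let V0 t := q0 t - E * r t.
Let P1 t := (p1 t)^-1.
Let V1 t := q1 t - E * r t.

Let sys0 : sl_system a P0 V0 u0 pu0.
Proof. by case: adm => _ [[[h _] _] _ _] _ _ _; exact/solution_system. Qed.
Let sysv : sl_system a P0 V0 v0 pv0.
Proof. by case: adm => _ [_ h _] _ _ _; exact/solution_system. Qed.
Let W1 x : a < x -> wronskian u0 pu0 v0 pv0 x = 1.
Proof. by case: adm => _ [_ _ h] _ _ _; exact: h. Qed.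
Let alpha_gt0 x : a < x -> 0 < alpha x.
Proof. by case: adm => _ _ [h _ _ _ _] _ _; exact: h. Qed.
Let beta_sign : (forall x, a < x -> 0 < beta x) \/ (forall x, a < x -> beta x < 0).
Proof. by case: adm => _ _ [_ h _ _ _] _ _. Qed.
Let beta_neq0 x : a < x -> beta x != 0.
Proof. by move=> ax; case: beta_sign => /(_ x ax) h; [rewrite gt_eqF|rewrite lt_eqF]. Qed.
Let prim_beta : primitive a beta beta'.
Proof. by case: adm => _ _ [_ _ h1 h2 h3] _ _; exact: prim_of_abs_cont. Qed.
Let rho_gt0 : {ae mu, forall x, a < x -> 0 < rho x}.
Proof. by case: adm => _ _ _ _ [h _ _]. Qed.
Let rho_cvg0 : rho x @[x --> ae_pinfty] --> (0 : R).
Proof. by case: adm => _ _ _ _ [_ h _]. Qed.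
Let rho_slow l : 0 < l ->
  (fun x => l^-1 * \int[mu]_(t in `[0, l]) `|rho (x + t) - rho x|) =o_ae_pinfty rho.
Proof. by case: adm => _ _ _ _ [_ _ h]; exact: h. Qed.
Let cont_beta : continuous_after a beta. Proof. exact: prim_cont prim_beta. Qed.
Let lrho : loc_integrable a rho.
Proof.
have -> : rho = (fun x => (beta x)^-1 * beta' x) by apply/funext => x; rewrite /rho mulrC.
by apply: lintM; [exact: contV|exact: prim_lint prim_beta].
Qed.

Let cont_u0 : continuous_after a u0 /\ continuous_after a pu0. Proof. exact: system_cont sys0. Qed.

Let F_meas : measurable_fun (halfline a) F.
Proof.
have mc f : continuous_after a f -> measurable_fun (halfline a) f.
  by move=> cf; apply: lint_meas; exact: lint_cont.
have mq : measurable_fun (halfline a) Dq.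
  case: coef0 => _ [h0 _ _] _ _ _; case: coef1 => _ [h1 _ _] _ _ _.
  exact: measurable_funB.
have mp : measurable_fun (halfline a) Dp.
  case: coef0 => [[h0 _ _]] _ _ _ _; case: coef1 => [[h1 _ _]] _ _ _ _.
  exact: measurable_funB.
have [cu cpu] := cont_u0.
have mb : measurable_fun (halfline a) (fun x => (beta' x)^-1).
  apply: (measurableT_comp measurable_invr).
  exact: lint_meas (prim_lint prim_beta).
apply: measurable_funM; first by apply: measurable_funM => //; apply: measurable_funX; exact: mc.
apply: measurable_funD; apply: measurable_funM => //; apply: measurable_funX; exact: mc.
Qed.

Let perturbation_O : exists2 C : R, 0 <= C & ae_pinfty [set t |
  `|Dq t| <= C * `|beta' t / ((alpha t) ^+ 2 * (beta t) ^+ 2)| /\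
  `|Dp t| <= C * `|beta' t / ((alpha t) ^+ 2 * (beta t) ^+ 2)|].
Proof.
move/eqO_exP : DqO => [C1 C10 h1]; move/eqO_exP : DpO => [C2 C20 h2].
exists (C1 + C2); first by rewrite addr_ge0// ltW.
apply: filterS2 h1 h2 => t h1 h2.
split; [apply: le_trans h1 _|apply: le_trans h2 _]; rewrite ler_wpM2r// ?lerDl ?lerDr ltW//.
Qed.

Let solution_O : exists2 M : R, 0 <= M & exists X, forall t, X < t ->
  `|u0 t| <= M * alpha t /\ `|pu0 t| <= M * alpha t.
Proof.
case: adm => _ _ _ [/eqO_exP[M M0 [X [_ hX]]] _] _.
exists M; first exact: ltW.
exists (Num.max X a) => t; rewrite gt_max => /andP[Xt at_].
have := hX t Xt; rewrite prod_normE/= ge_max (gtr0_norm (alpha_gt0 at_)).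
by move=> /andP[].
Qed.

Let second_solution_o e : 0 < e -> exists X, forall t, X < t ->
  `|v0 t - beta t * u0 t| <= e * `|alpha t * beta t| /\
  `|pv0 t - beta t * pu0 t| <= e * `|alpha t * beta t|.
Proof.
move=> e0; case: adm => _ _ _ [_ /eqoP/(_ e e0)[X [_ hX]]] _.
exists X => t Xt; have := hX t Xt.
by rewrite prod_normE/= ge_max => /andP[].
Qed.

Let F_bounded (M : R) : 0 <= M -> (exists X, forall t, X < t ->
  `|u0 t| <= M * alpha t /\ `|pu0 t| <= M * alpha t) ->
  forall C : R, 0 <= C -> ae_pinfty [set t |
  `|Dq t| <= C * `|beta' t / ((alpha t) ^+ 2 * (beta t) ^+ 2)| /\
  `|Dp t| <= C * `|beta' t / ((alpha t) ^+ 2 * (beta t) ^+ 2)|] ->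
  ae_pinfty [set t | `|F t| <= 2 * C * M ^+ 2].
Proof.
move=> M0 [X hX] C C0 [Y hY]; exists (Num.max a (Num.max X Y)).
apply: filterS2 hY rho_gt0 => t hY ht; rewrite !gt_max => /and3P[at_ Xt Yt].
have [h1 h2] := hX t Xt; have [h3 h4] := hY Yt.
by apply: (@perturbation_bound _ _ _ _ _ _ _ (alpha t)) => //; [exact: alpha_gt0|exact: beta_neq0|exact: ht].
Qed.

(** Pass to the coefficients of the solution in the basis (u0, v0) and to the angle of
    [(A + beta * B, beta * B)]. *)
Let effective_angle u1 pu1 : sl_system a P1 V1 u1 pu1 ->
  (forall x, a < x -> pu1 x ^+ 2 + u1 x ^+ 2 != 0) ->
  exists A A' B B' psi g rpsi,
  [/\ primitive a A A', primitive a B B', primitive a psi g,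
    forall x, a < x -> u1 x = A x * u0 x + B x * v0 x /\ pu1 x = A x * pu0 x + B x * pv0 x &
    (forall x, a < x -> [/\ 0 < rpsi x, A x + beta x * B x = rpsi x * cos (psi x) &
      beta x * B x = rpsi x * sin (psi x)]) /\
    forall e, 0 < e ->
      ae_pinfty [set t | `|g t - rho t * slow_field (psi t) (F t)| <= e * rho t]].
Proof.
move=> sys1 nz.
pose A := fun x => - wronskian v0 pv0 u1 pu1 x.
pose B := wronskian u0 pu0 u1 pu1.
pose A' := fun t => - (Dq t * (v0 t * u1 t) + Dp t * (pv0 t * pu1 t)).
pose B' := fun t => Dq t * (u0 t * u1 t) + Dp t * (pu0 t * pu1 t).
have pA : primitive a A A'.
  by apply: prim_ext (primN (prim_wronskian sysv sys1)) _ => t _;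
    rewrite /A' /Dq /Dp /V1 /V0 /P0 /P1; ring.
have pB : primitive a B B'.
  by apply: prim_ext (prim_wronskian sys0 sys1) _ => t _;
    rewrite /B' /Dq /Dp /V1 /V0 /P0 /P1; ring.
have uE x : a < x -> u1 x = A x * u0 x + B x * v0 x /\ pu1 x = A x * pu0 x + B x * pv0 x.
  move=> /W1 w1; split.
    rewrite -[LHS]mulr1 -w1 /A /B /wronskian; ring.
  rewrite -[LHS]mulr1 -w1 /A /B /wronskian; ring.
have pz := primM prim_beta pB.
have py := primD pA pz.
have nzyz x : a < x -> (A x + beta x * B x) ^+ 2 + (beta x * B x) ^+ 2 != 0.
  move=> ax; apply/negP; rewrite paddr_eq0 ?sqr_ge0// !expf_eq0/= => /andP[/eqP y0 /eqP z0].
  have A0 : A x = 0 by rewrite z0 addr0 in y0.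
  have B0 : B x = 0 by apply/eqP; move/eqP : z0; rewrite mulf_eq0 (negbTE (beta_neq0 ax)).
  have [e1 e2] := uE x ax.
  by have := nz x ax; rewrite e1 e2 A0 B0 !mul0r addr0 expr0n/= addr0 eqxx.
have [psi [rpsi [ppsi hpsi]]] := polar_angle py pz nzyz.
pose g t := ((A t + beta t * B t) * (beta' t * B t + beta t * B' t) -
     (A' t + (beta' t * B t + beta t * B' t)) * (beta t * B t)) /
    ((A t + beta t * B t) ^+ 2 + (beta t * B t) ^+ 2).
exists A, A', B, B', psi, g, rpsi; split; [exact: pA|exact: pB|exact: ppsi|exact: uE|].
split; first exact: hpsi.
move=> e e0.
have [C C0 hC] := perturbation_O.
have [M M0 [X hX]] := solution_O.
have [d d0 hd] : exists2 d : R, 0 < d & 4 * C * M * d + 2 * C * d ^+ 2 <= e.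
  pose k := 4 * C * M + 2 * C + 1.
  have k0 : 0 < k by rewrite /k ltr_wpDl// addr_ge0// !mulr_ge0.
  exists (Num.min 1 (e / k)); first by rewrite lt_min ltr01 divr_gt0.
  set d := Num.min _ _.
  have d1 : d <= 1 by rewrite ge_min lexx.
  have d0 : 0 <= d by rewrite le_min ler01 divr_ge0// ltW.
  have dk : k * d <= e by rewrite mulrC -ler_pdivlMr// ge_min lexx orbT.
  apply: le_trans dk; rewrite /k !mulrDl mul1r.
  have : 2 * C * d ^+ 2 <= 2 * C * d.
    by rewrite ler_wpM2l// ?mulr_ge0// expr2 ler_piMl.
  by lra.
have [Y hY] := second_solution_o d0.
case: hC => Z hZ.
exists (Num.max a (Num.max X (Num.max Y Z))).
apply: filterS2 hZ rho_gt0 => t hZ ht; rewrite !gt_max => /and4P[at_ Xt Yt Zt] /=.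
have [h1 h2] := hX t Xt; have [h3 h4] := hY t Yt; have [h5 h6] := hZ Zt.
have r0 := ht at_.
have b'0 : beta' t != 0 by apply/eqP => b0; move: r0; rewrite /rho b0 mul0r ltxx.
have [rp0 yE zE] := hpsi t at_.
have [uEt puEt] := uE t at_.
have := @angle_speed_identity R (u0 t) (pu0 t) (v0 t) (pv0 t) (A t) (B t) (beta t) (beta' t)
   (Dq t) (Dp t) (rpsi t) (psi t) (beta_neq0 at_) b'0 rp0 yE zE.
rewrite /= -uEt -puEt => idt.
have -> : g t - rho t * slow_field (psi t) (F t) =
   2 * (Dq t * (u0 t * (v0 t - beta t * u0 t)) + Dp t * (pu0 t * (pv0 t - beta t * pu0 t))) *
     (sin (psi t) * cos (psi t)) +
   (Dq t * (v0 t - beta t * u0 t) ^+ 2 + Dp t * (pv0 t - beta t * pu0 t) ^+ 2) / beta t * sin (psi t) ^+ 2.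
  exact: idt.
apply: le_trans (@angle_speed_error R (u0 t) (pu0 t) _ _ (beta t) (beta' t) (Dq t) (Dp t)
   (alpha t) C M d (psi t) (alpha_gt0 at_) (beta_neq0 at_) r0 C0 M0 (ltW d0) h5 h6 h1 h2 h3 h4) _.
by rewrite ler_wpM2r// ltW.
Qed.


Let combination w pw : solution a p0 q0 r E w pw -> exists c d, forall x, a < x ->
  w x = c * u0 x + d * v0 x /\ pw x = c * pu0 x + d * pv0 x.
Proof.
move=> /(solution_system _ _ _ coef0) sw.
have ax0 : a < a + 1 by rewrite ltrDl.
exists (- wronskian v0 pv0 w pw (a + 1)), (wronskian u0 pu0 w pw (a + 1)) => x ax.
rewrite (wronskian_const sysv sw ax0 ax) (wronskian_const sys0 sw ax0 ax).
by have w1 := W1 ax; split; rewrite -[LHS]mulr1 -w1 /wronskian; ring.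
Qed.

(** [beta] is a constant times the exponential of the integral of [rho]. *)
Let beta_limit : ~ (forall B X, a < X -> exists2 y, X <= y & B <= intg X y rho) ->
  exists b : R, forall e, 0 < e -> exists X, forall t, X < t -> `|beta t - b| <= e.
Proof.
move=> /existsNP[B /existsNP[X /not_implyP[aX nB]]].
have {}nB y : X <= y -> intg X y rho <= B.
  by move=> Xy; rewrite leNgt; apply/negP => /ltW By; apply: nB; exists y.
have [H pH H0] := lint_prim aX lrho.
have pb : primitive a beta (fun t => rho t * beta t).
  by apply: prim_ext prim_beta _ => t at_; rewrite /rho mulfVK// beta_neq0.
have bE y : a < y -> beta y = beta X * expR (H y).
  by move=> ay; rewrite (prim_linear pH pb aX ay) H0 subr0.
pose k y := H (Num.max X y).
have Xm y : X <= Num.max X y by rewrite le_max lexx.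
have kmono : {homo k : x y / x <= y}.
  move=> x y xy; rewrite /k -subr_ge0; have [_ ->] := pH.
  - have := int_cst (0 : R) (_ : Num.max X x <= Num.max X y).
    rewrite mul0r => <-; last by rewrite ge_max !le_max lexx xy orbT.
    apply: le_int_ae; [exact: intbl_cst|by apply: lrho; exact: lt_le_trans (Xm x)|].
    apply: filterS rho_gt0 => t h /andP[ht _]; apply/ltW/h.
    by apply: lt_le_trans ht; exact: lt_le_trans (Xm x).
  - exact: lt_le_trans (Xm x).
  - by rewrite ge_max !le_max lexx xy orbT.
have kub : has_ubound (range k).
  exists B => _ [y _ <-]; rewrite /k -[H _]subr0 -H0.
  by have [_ ->//] := pH; exact: nB.
have kc := nondecreasing_cvgr kmono kub.
exists (beta X * expR (sup (range k))) => e e0.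
have : beta X * expR (k t) @[t --> +oo] --> beta X * expR (sup (range k)).
  by apply: cvgM; [exact: cvg_cst|apply: continuous_cvg => //; exact: continuous_expR].
move=> /cvgrPdist_le/(_ e e0)[Y [_ hY]].
exists (Num.max X Y) => t; rewrite gt_max => /andP[Xt Yt].
have := hY t Yt; rewrite distrC /k (max_r (ltW Xt)).
by rewrite -bE//; exact: lt_trans Xt.
Qed.

(** If [v0 - b u0] vanished identically, so would its quasi-derivative, as [p0 > 0] a.e.;
    but its Wronskian with [u0] is 1. *)
Let second_solution b : nontrivial_solution a p0 q0 r E
  (fun x => v0 x - b * u0 x) (fun x => pv0 x - b * pu0 x).
Proof.
have [h1 h2] := sys0; have [h3 h4] := sysv.
have sol : solution a p0 q0 r E (fun x => v0 x - b * u0 x) (fun x => pv0 x - b * pu0 x).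
  apply/solution_system => //; split.
    by apply: prim_ext (primB h3 (primZ b h1)) _ => t _; rewrite /P0; ring.
  by apply: prim_ext (primB h4 (primZ b h2)) _ => t _; rewrite /V0; ring.
split=> //; apply: contrapT => triv.
have v0E x : a < x -> v0 x - b * u0 x = 0.
  by move=> ax; apply/eqP; apply: contrapT => /negP nz; apply: triv; exists x.
have [_ _ dv _] := sol.
have pp : {ae mu, forall x, a < x -> 0 < p0 x} by case: coef0.
have aa1 : a < a + 1 by rewrite ltrDl.
have [x /andP[ax _] [h5 h6]] := ae_exists_between (aeI dv pp) aa1.
have d0 : is_derive x 1 (fun x => v0 x - b * u0 x) 0.
  apply: (@near_eq_is_derive _ _ _ (cst 0)).
  by near=> y; rewrite v0E//; near: y; exact: lt_nbhsr.
have [_ e1] := h5 ax; have [_ e2] := d0.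
have pv00 : pv0 x - b * pu0 x = 0.
  have /eqP : (pv0 x - b * pu0 x) / p0 x = 0 by rewrite -e1 e2.
  by rewrite mulf_eq0 invr_eq0 (gt_eqF (h6 ax)) orbF => /eqP.
have : wronskian u0 pu0 v0 pv0 x = 0.
  transitivity (u0 x * (pv0 x - b * pu0 x) - pu0 x * (v0 x - b * u0 x)).
    by rewrite /wronskian; ring.
  by rewrite pv00 v0E// !mulr0 subrr.
by rewrite W1// => /eqP; rewrite oner_eq0.
Unshelve. all: by end_near. Qed.

(** If the integral of [rho] converges, [beta] tends to some [b], and [v0 - b u0] is
    [o(alpha)].  The minimal solution [u0] is bounded by it, hence also [o(alpha)]. *)
Let F_small : ~ (forall B X, a < X -> exists2 y, X <= y & B <= intg X y rho) ->
  forall e, 0 < e -> ae_pinfty [set t | `|F t| <= e].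
Proof.
move=> /beta_limit[b hb] e e0.
have [C C0 hC] := perturbation_O; have [M M0 [X1 hX1]] := solution_O.
have minu : (fun x => (u0 x, pu0 x)) =O_+oo (fun x => (v0 x - b * u0 x, pv0 x - b * pu0 x)).
  by case: adm => _ [[_ h] _ _] _ _ _; apply: h; exact: second_solution.
have [k k0 [X2 [_ hX2]]] := (eqO_exP _ _ _).1 minu.
pose m := Num.min 1 (e / (2 * C + 1)).
have C1 : 0 < 2 * C + 1 by rewrite ltr_wpDl// mulr_ge0.
have m0 : 0 < m by rewrite lt_min ltr01 divr_gt0.
have m1 : m <= 1 by rewrite ge_min lexx.
have mC : 2 * C * m <= e.
  have : (2 * C + 1) * m <= e by rewrite mulrC -ler_pdivlMr// ge_min lexx orbT.
  by rewrite mulrDl mul1r; lra.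
(* v0 - b u0 = (v0 - beta u0) + (beta - b) u0; [e1] and [e2] bound each part by half
   of [m / k * alpha] *)
pose e1 := m / k / 2 / (`|b| + 1); pose e2 := m / k / 2 / (M + 1).
have b1 : 0 < `|b| + 1 by rewrite ltr_wpDl.
have M1 : 0 < M + 1 by rewrite ltr_wpDl.
have e10 : 0 < e1 by rewrite !divr_gt0.
have e20 : 0 < e2 by rewrite !divr_gt0.
have [X3 hX3] := second_solution_o e10.
have [X4 hX4] := hb e2 e20.
have [X5 hX5] := hb 1 ltr01.
have small : exists X, forall t, X < t -> `|u0 t| <= m * alpha t /\ `|pu0 t| <= m * alpha t.
  exists (Num.max a (Num.max X1 (Num.max X2 (Num.max X3 (Num.max X4 X5))))) => t.
  rewrite !gt_max => /and4P[at_ t1 t2 /and3P[t3 t4 t5]].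
  have al0 := alpha_gt0 at_.
  have [f1 f2] := hX1 t t1; have f3 := hX2 t t2; have [f4 f5] := hX3 t t3.
  have f6 := hX4 t t4; have f7 := hX5 t t5.
  have nb : `|beta t| <= `|b| + 1.
    have -> : beta t = b + (beta t - b) by ring.
    by apply: le_trans (ler_normD _ _) _; rewrite lerD2l.
  have key (v u : R) : `|v - beta t * u| <= e1 * `|alpha t * beta t| -> `|u| <= M * alpha t ->
      `|v - b * u| <= m / k * alpha t.
    move=> g1 g2; have -> : v - b * u = (v - beta t * u) + (beta t - b) * u by ring.
    apply: le_trans (ler_normD _ _) _.
    have -> : m / k * alpha t = m / k / 2 * alpha t + m / k / 2 * alpha t.
      by rewrite -mulrDl -splitr.
    apply: lerD.
      apply: le_trans g1 _; rewrite normrM (gtr0_norm al0).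
      have -> : m / k / 2 * alpha t = e1 * (alpha t * (`|b| + 1)).
        by rewrite /e1; field; rewrite !gt_eqF.
      by rewrite ler_pM2l// ler_pM2l.
    rewrite normrM; apply: le_trans (ler_pM _ _ f6 g2) _ => //.
    have -> : m / k / 2 * alpha t = e2 * ((M + 1) * alpha t).
      by rewrite /e2; field; rewrite !gt_eqF.
    by rewrite ler_pM2l// ler_pM2r// lerDl.
  have g1 := key _ _ f4 f1; have g2 := key _ _ f5 f2.
  move: f3; rewrite !prod_normE/= ge_max => /andP[f8 f9].
  have mx : k * Num.max `|v0 t - b * u0 t| `|pv0 t - b * pu0 t| <= m * alpha t.
    have -> : m * alpha t = k * (m / k * alpha t) by field; rewrite gt_eqF.
    by rewrite ler_pM2l// ge_max g1.
  by split; [exact: le_trans f8 mx|exact: le_trans f9 mx].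
apply: filterS (F_bounded (ltW m0) small C0 hC) => t /= h.
apply: le_trans h _; apply: le_trans mC.
by rewrite ler_wpM2l ?mulr_ge0// expr2 ger_pMl.
Qed.

Let mean_bound e l : 0 < e -> 0 < l -> ae_pinfty [set t | `|F t| <= e] ->
  exists X, forall x, X <= x -> `|window_mean F l x| <= e.
Proof.
move=> e0 l0 [Y hY]; exists (Num.max a Y + 1) => x hx.
have [ax Yx] : a < x /\ Y < x.
  have := lerDl (Num.max a Y) (1 : R); rewrite ler01 => h1.
  have h2 : a <= Num.max a Y by rewrite le_max lexx.
  have h3 : Y <= Num.max a Y by rewrite le_max lexx orbT.
  by split; lra.
have hF : {ae mu, forall t, x <= t <= x + l -> `|F t| <= e}.
  by apply: filterS hY => t h /andP[xt _]; apply: h; exact: lt_le_trans xt.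
have iF : itv_integrable x (x + l) F.
  apply: intbl_ae_bound (ltW e0) _ hF.
  apply: measurable_funS F_meas => //; first exact: measurable_itv.
  by move=> t /=; rewrite /halfline /= !in_itv/= andbT => /andP[xt _]; exact: lt_le_trans xt.
rewrite /window_mean normrM gtr0_norm ?invr_gt0// ler_pdivrMl//.
have -> : l * e = e * (x + l - x) by ring.
rewrite -int_cst//; last by rewrite lerDl ltW.
by apply: norm_int_le_ae => //; exact: intbl_cst.
Qed.

Let relative_slow_motion w0 pw0 th0 w1 pw1 th1 :
  solution a p0 q0 r E w0 pw0 -> solution a p1 q1 r E w1 pw1 ->
  prufer_angle a w0 pw0 th0 -> prufer_angle a w1 pw1 th1 ->
  exists psi CF M s, [/\ 0 <= CF, slow_motion a CF rho F psi, s = 1 \/ s = -1 &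
    forall x, a < x -> `|(th1 x - th0 x) + s * psi x| <= M].
Proof.
move=> so0 /(solution_system _ _ _ coef1) sys1 pr0 pr1.
have [A [A' [B [B' [psi [g [rpsi [pA pB ppsi uE [hpsi hg]]]]]]]]] :=
  effective_angle sys1 (prufer_nonvanishing pr1).
have [c [d hcd]] := combination so0.
have [M [s [hs hM]]] := relative_angle W1 pA pB beta_sign hcd uE pr0 pr1 (prim_cont ppsi) hpsi.
have [C C0 hC] := perturbation_O; have [m m0 hm] := solution_O.
have CF0 : 0 <= 2 * C * m ^+ 2 by rewrite !mulr_ge0// sqr_ge0.
exists psi, (2 * C * m ^+ 2), M, s; split => // l e l0 e0.
exact: (window_step lrho F_meas rho_gt0 rho_cvg0 rho_slow ppsi CF0 (F_bounded m0 hm C0 hC) hg l0 e0).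
Qed.

Let angles_bounded_left w0 pw0 th0 w1 pw1 th1 X :
  solution a p0 q0 r E w0 pw0 -> solution a p1 q1 r E w1 pw1 ->
  prufer_angle a w0 pw0 th0 -> prufer_angle a w1 pw1 th1 ->
  exists M, forall x, a < x -> x <= X -> `|th1 x - th0 x| <= M.
Proof.
move=> so0 so1 pr0 pr1.
have [M0 h0] := prufer_bounded_left coef0 reg0 so0 pr0 X.
have [M1 h1] := prufer_bounded_left coef1 reg1 so1 pr1 X.
exists (M1 + M0) => x ax xX; apply: le_trans (ler_normB _ _) _.
by apply: lerD; [exact: h1|exact: h0].
Qed.

Lemma relative_oscillation : (inf_limsup_mean F < (- (1 / 4))%:E)%E ->
  rel_oscillatory a p0 q0 p1 q1 r E.
Proof.
move=> /inf_limsup_lt[l [d [X0 [l0 d0 hF]]]].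
(* otherwise F tends to 0 and its means exceed -1/4 *)
have unb : forall B X, a < X -> exists2 y, X <= y & B <= intg X y rho.
  apply: contrapT => /F_small/(_ (1 / 4))/(_ ltac:(by rewrite divr_gt0)) small.
  have q0' : 0 < 1 / 4 :> R by rewrite divr_gt0.
  have [X hX] := mean_bound q0' l0 small.
  have := hX (Num.max X X0); rewrite le_max lexx => /(_ isT).
  have := hF (Num.max X X0); rewrite le_max lexx orbT => /(_ isT).
  by rewrite ler_norml => h1 /andP[h2 _]; lra.
have [w0 [pw0 [th0 [nt0 pr0]]]] := exists_prufer E coef0 reg0.
have [w1 [pw1 [th1 [nt1 pr1]]]] := exists_prufer E coef1 reg1.
have [so0 _] := nt0; have [so1 _] := nt1.
exists w0, pw0, w1, pw1, th0, th1; split => //.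
have [psi [CF [M [s [CF0 sm hs hM]]]]] := relative_slow_motion so0 so1 pr0 pr1.
have [M2 hM2] := angles_bounded_left (a + 1) so0 so1 pr0 pr1.
have {}hM2 c : a < c -> c < a + 1 -> `|th1 c - th0 c| <= M2.
  by move=> ac /ltW; exact: hM2.
have dec := slow_motion_decreasing sm lrho rho_gt0 l0 d0 hF unb.
have {}dec N X : exists2 x, X < x /\ a < x & psi x <= N.
  have [x hx px] := dec N (Num.max X a + 1); exists x => //.
  have h2 : X <= Num.max X a by rewrite le_max lexx.
  have h3 : a <= Num.max X a by rewrite le_max lexx orbT.
  by split; lra.
case: hs hM => -> hM.
- right; rewrite (rel_count_unbounded_up hM2)// => N X.
  have [x [Xx ax] px] := dec (- N - M) X; exists x => //.
  by have := hM x ax; rewrite mul1r ler_norml => /andP[h _]; lra.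
- left; rewrite (rel_count_unbounded_down hM2)// => N X.
  have [x [Xx ax] px] := dec (N - M) X; exists x => //.
  by have := hM x ax; rewrite mulN1r ler_norml => /andP[_ h]; lra.
Qed.

Lemma relative_nonoscillation : (sup_liminf_mean F > (- (1 / 4))%:E)%E ->
  rel_nonoscillatory a p0 q0 p1 q1 r E.
Proof.
move=> /sup_liminf_gt[l [d [X0 [l0 d0 hF]]]].
move=> w0 pw0 w1 pw1 th0 th1 [so0 _] [so1 _] pr0 pr1.
have [psi [CF [M [s [CF0 sm hs hM]]]]] := relative_slow_motion so0 so1 pr0 pr1.
have [X aX [N hN]] := slow_motion_bounded sm l0 d0 hF.
have [M2 hM2] := angles_bounded_left X so0 so1 pr0 pr1.
apply: (@rel_count_bounded _ _ _ _ (`|M| + N + `|M2|)) => x ax.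
have N0 : 0 <= N by apply: le_trans (hN X (lexx X)).
have [xX|Xx] := leP x X.
  apply: le_trans (hM2 x ax xX) _; apply: le_trans (ler_norm _) _.
  by rewrite lerDr addr_ge0.
have -> : th1 x - th0 x = (th1 x - th0 x + s * psi x) - s * psi x by ring.
apply: le_trans (ler_normB _ _) _.
have -> : `|s * psi x| = `|psi x| by case: hs => ->; rewrite ?mul1r// mulN1r normrN.
have h1 : `|th1 x - th0 x + s * psi x| <= `|M|.
  by apply: le_trans (hM x ax) _; exact: ler_norm.
have h2 := hN x (ltW Xx); have h3 := normr_ge0 M2.
by lra.
Qed.

End RelativeOscillation.

Theorem theorem2p8 (R : realType) (a : R) (p0 q0 p1 q1 r : R -> R)
    (phi E : R) (u0 pu0 v0 pv0 alpha beta beta' : R -> R)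
    (coef0 : sl_coefficients a p0 q0 r) (coef1 : sl_coefficients a p1 q1 r)
    (reg0 : regular_at_left a p0 q0 r) (reg1 : regular_at_left a p1 q1 r)
    (lp0 : limit_point_pinfty a p0 q0 r) (lp1 : limit_point_pinfty a p1 q1 r)
    (adm : admissible a p0 q0 r phi E u0 pu0 v0 pv0 alpha beta beta') :
  let Dq := fun x => q1 x - q0 x in
  let Dp := fun x => (p0 x)^-1 - (p1 x)^-1 in
  let F := fun t => (beta t) ^+ 2 / beta' t *
                    ((u0 t) ^+ 2 * Dq t + (pu0 t) ^+ 2 * Dp t) in
  Dq =O_ae_pinfty (fun x => beta' x / ((alpha x) ^+ 2 * (beta x) ^+ 2)) ->
  Dp =O_ae_pinfty (fun x => beta' x / ((alpha x) ^+ 2 * (beta x) ^+ 2)) ->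
  ((inf_limsup_mean F < (- (1 / 4))%:E)%E ->
     rel_oscillatory a p0 q0 p1 q1 r E) /\
  ((sup_liminf_mean F > (- (1 / 4))%:E)%E ->
     rel_nonoscillatory a p0 q0 p1 q1 r E).
Proof.
move=> Dq Dp F DqO DpO; split.
- exact: (relative_oscillation coef0 coef1 reg0 reg1 adm DqO DpO).
- exact: (relative_nonoscillation coef0 coef1 reg0 reg1 adm DqO DpO).
Qed.
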